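(* Let $R=k[X_0,\ldots,X_n]/\mathfrak{a}$, let $\mathfrak{F}:\mathbf{f}\subset R$ be an $m$-targeted rational map, and set $S=k[\mathbf{Y}]/\mathfrak{b}\simeq k[\mathbf{f}]\subset R$. If $\mathfrak{F}$ has a Jacobian dual rank, then $$\dim R-\dim S\;\leq\; n-\mathrm{jdrank}(\mathfrak{F})\;=\;\mathrm{edim}(R)-1-\mathrm{jdrank}_+(\mathfrak{F}).$$
   Context: Setting. $k$ is an arbitrary field; $R=k[X_0,\ldots,X_n]/\mathfrak{a}=k[x_0,\ldots,x_n]$ is a reduced standard graded $k$-algebra ($\mathfrak{a}$ homogeneous) with $\dim R\ge 1$. $\mathrm{edim}(R):=\dim_k R_1=n+1-\dim_k\mathfrak{a}_1$ and $\mathrm{dgi}(\mathfrak{a}):=n+1-\mathrm{edim}(R)=\dim_k\mathfrak{a}_1$. $\dim$ is Krull dimension. Rational maps. Two ordered sets $\mathbf{f}=\{f_0,\ldots,f_m\}$, $\mathbf{f}'=\{f'_0,\ldots,f'_m\}$ of forms in $R$ (each set consisting of forms of one same degree) are equivalent if there are regular homogeneous elements $F,F'\in R$ with $Ff'_j=F'f_j$ for all $j$. A rational $(m+1)$-datum of degree $d$ on $R$ is an ordered set $\mathbf{f}=\{f_0,\ldots,f_m\}\subset R$ of forms of the same degree $d\geq 1$ such that (1) $R$ is torsionfree over the subring $k[\mathbf{f}]$ (i.e. every minimal prime of $R$ contracts to a minimal prime of $k[\mathbf{f}]$), and (2) the ideal $(\mathbf{f})R$ is not contained in any minimal prime of $R$.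 An $m$-targeted rational map $\mathfrak{F}$ with source $\mathrm{Proj}(R)$ is an equivalence class of rational $(m+1)$-data; one writes $\mathfrak{F}:\mathbf{f}\subset R$ for a representative $\mathbf{f}$. All representatives share a common standard graded presentation $S=k[\mathbf{Y}]/\mathfrak{b}=k[Y_0,\ldots,Y_m]/\mathfrak{b}\simeq k[\mathbf{f}]$, $Y_j\mapsto f_j$ (after degree renormalization). Jacobian dual rank. Let $\mathcal{J}=\ker(R[\mathbf{Y}]\to\mathcal{R}_R((\mathbf{f})))$, $Y_j\mapsto f_jt$, where $\mathcal{R}_R((\mathbf{f}))=R[\mathbf{f}t]$ is the Rees algebra of the ideal $(\mathbf{f})$. It is bihomogeneous for the bigrading in which $x_i$ has bidegree $(1,0)$ and $Y_j$ has bidegree $(0,1)$; let $\mathcal{J}_{1,*}=\bigoplus_{q}\mathcal{J}_{1,q}$ and let $(\mathcal{J}_{1,*})\subset R[\mathbf{Y}]$ be the ideal it generates. Choose a minimal set of generators of $(\mathcal{J}_{1,*})$ consisting of forms of bidegrees $(1,q)$ for various $q$, lift them to forms $P_1,\ldots,P_s\in k[\mathbf{X},\mathbf{Y}]$ of the same bidegrees, and let $\ell_1,\ldots,\ell_r$ be a $k$-basis of $\mathfrak{a}_1$. The Jacobian matrix of $\{\ell_1,\ldots,\ell_r,P_1,\ldots,P_s\}$ with respect to $X_0,\ldots,X_n$ (rows indexed by the polynomials, columns by the $X_i$) has entries in $k[\mathbf{Y}]$; the corresponding matrix $\psi$ over $S$ is called a Jacobian dual matrix of $\mathfrak{F}$.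 A matrix over a ring has rank $\rho$ if all its minors of size $>\rho$ vanish and the ideal of its $\rho$-minors contains a regular element. $\mathfrak{F}$ has a Jacobian dual rank if some (equivalently, every) Jacobian dual matrix $\psi$ has a rank over $S$; this rank is $\mathrm{jdrank}(\mathfrak{F})$, and $\mathrm{jdrank}_+(\mathfrak{F}):=\mathrm{jdrank}(\mathfrak{F})-\mathrm{dgi}(\mathfrak{a})$. *)

(* Defs.v *)
From Stdlib Require Import ClassicalEpsilon.
From HB Require Import structures.
From mathcomp Require Import all_boot all_order all_algebra.
From mathcomp Require Export mpoly.

Set Implicit Arguments.
Unset Strict Implicit.
Unset Printing Implicit Defensive.

Import Order.TTheory GRing.Theory Num.Theory.
Local Open Scope ring_scope.

(* The number characterized by P. It is applied only to invariants that exist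
   and are unique in the setting of the theorem; otherwise its value is
   arbitrary. *)
Definition the_nat (P : nat -> Prop) : nat := epsilon (inhabits 0%N) P.

(* Ideals are Prop-valued subsets, so that no decidability is imposed. *)
Definition is_ideal (A : comNzRingType) (I : A -> Prop) : Prop :=
  [/\ I 0, forall x y, I x -> I y -> I (x + y) & forall a x, I x -> I (a * x)].

Definition prime_ideal (A : comNzRingType) (I : A -> Prop) : Prop :=
  [/\ is_ideal I, ~ I 1 & forall x y, I (x * y) -> I x \/ I y].

Definition subideal (A : comNzRingType) (I J : A -> Prop) : Prop :=
  forall x, I x -> J x.

Definition minimal_prime (A : comNzRingType) (P : A -> Prop) : Prop :=
  prime_ideal P /\
  forall Q : A -> Prop, prime_ideal Q -> subideal Q P -> subideal P Q.

Definition ideal_gen (A : comNzRingType) (G : A -> Prop) (x : A) : Prop :=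
  forall I : A -> Prop, is_ideal I -> subideal G I -> I x.

Definition prime_chain (A : comNzRingType) (d : nat) : Prop :=
  exists c : nat -> A -> Prop,
    (forall i, (i <= d)%N -> prime_ideal (c i)) /\
    (forall i, (i < d)%N ->
       subideal (c i) (c i.+1) /\ ~ subideal (c i.+1) (c i)).

Definition krull_dim (A : comNzRingType) : nat :=
  the_nat (fun d =>
    prime_chain A d /\ forall e, prime_chain A e -> (e <= d)%N).

Definition reduced (A : comNzRingType) : Prop :=
  forall (x : A) (e : nat), x ^+ e = 0 -> x = 0.

Definition is_basis (k : fieldType) (V : lmodType k) (W : V -> Prop)
    (r : nat) (e : 'I_r -> V) : Prop :=
  [/\ forall i, W (e i),
      forall v, W v -> exists c : 'I_r -> k, v = \sum_i c i *: e i
    & forall c : 'I_r -> k, \sum_i c i *: e i = 0 -> forall i, c i = 0].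

Definition vdim (k : fieldType) (V : lmodType k) (W : V -> Prop) : nat :=
  the_nat (fun r => exists e : 'I_r -> V, is_basis W e).

(* Rows and columns of a minor are selected by arbitrary maps: compared with
   increasing ones this only adds zeros and sign changes. *)
Definition is_minor (A : comNzRingType) (p q : nat) (M : 'M[A]_(p, q))
    (t : nat) (x : A) : Prop :=
  exists (u : 'I_t -> 'I_p) (v : 'I_t -> 'I_q), x = \det (mxsub u v M).

Definition has_rank (A : comNzRingType) (p q : nat) (M : 'M[A]_(p, q))
    (rho : nat) : Prop :=
  (forall t x, (rho < t)%N -> is_minor M t x -> x = 0) /\
  (exists2 x, ideal_gen (is_minor M rho) x & GRing.lreg x).

Definition homogeneous_ideal (k : fieldType) (n : nat)
    (a : {mpoly k[n]} -> Prop) : Prop :=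
  is_ideal a /\ forall p d, a p -> a (pihomog mdeg d p).

(* pi : k[X] -> R is, up to isomorphism, the projection k[X] -> k[X]/a. *)
Definition is_quotient (k : fieldType) (n : nat) (a : {mpoly k[n]} -> Prop)
    (R : comAlgType k) (pi : {mpoly k[n]} -> R) : Prop :=
  (forall x, exists p, pi p = x) /\ (forall p, pi p = 0 <-> a p).

Definition form (k : fieldType) (n : nat) (R : comAlgType k)
    (pi : {mpoly k[n]} -> R) (d : nat) (x : R) : Prop :=
  exists2 p, p \is d.-homog & pi p = x.

Definition edim (k : fieldType) (n : nat) (R : comAlgType k)
    (pi : {mpoly k[n]} -> R) : nat := vdim (form pi 1).

Definition linear_part (k : fieldType) (n : nat) (a : {mpoly k[n]} -> Prop)
    (p : {mpoly k[n]}) : Prop := a p /\ p \is 1.-homog.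

Definition dgi (k : fieldType) (n : nat) (a : {mpoly k[n]} -> Prop) : nat :=
  vdim (linear_part a).

Definition eval_at (k : fieldType) (m : nat) (R : comAlgType k)
    (f : 'I_m -> R) (p : {mpoly k[m]}) : R := mmap (in_alg R) f p.

Definition in_subalg (k : fieldType) (m : nat) (R : comAlgType k)
    (f : 'I_m -> R) (x : R) : Prop := exists p, x = eval_at f p.

(* The ideal b of k[Y] with k[Y]/b = k[f]. *)
Definition relations (k : fieldType) (m : nat) (R : comAlgType k)
    (f : 'I_m -> R) (p : {mpoly k[m]}) : Prop := eval_at f p = 0.

Definition torsionfree_over (R : comNzRingType) (B : R -> Prop) : Prop :=
  forall b, B b -> (forall c, B c -> b * c = 0 -> c = 0) ->
  forall x : R, b * x = 0 -> x = 0.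

Definition family_ideal (A : comNzRingType) (m : nat) (f : 'I_m -> A) :
    A -> Prop := ideal_gen (fun x => exists j, x = f j).

Definition rational_datum (k : fieldType) (n m : nat) (R : comAlgType k)
    (pi : {mpoly k[n.+1]} -> R) (d : nat) (f : 'I_m.+1 -> R) : Prop :=
  [/\ (0 < d)%N,
      forall j, form pi d (f j),
      torsionfree_over (in_subalg f)
    & forall P, minimal_prime P -> ~ subideal (family_ideal f) P].

Definition equivalent_forms (k : fieldType) (n m : nat) (R : comAlgType k)
    (pi : {mpoly k[n.+1]} -> R) (f g : 'I_m.+1 -> R) : Prop :=
  exists F G : R,
    [/\ exists d, form pi d F, exists d, form pi d G, GRing.lreg F,
        GRing.lreg G & forall j, F * g j = G * f j].

Definition rational_map (k : fieldType) (n m : nat) (R : comAlgType k)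
    (pi : {mpoly k[n.+1]} -> R) (FF : ('I_m.+1 -> R) -> Prop) : Prop :=
  exists2 f, exists d, rational_datum pi d f
  & forall g,
      FF g <-> (exists d, rational_datum pi d g) /\ equivalent_forms pi f g.

Definition rees_map (m : nat) (R : comNzRingType) (f : 'I_m -> R)
    (P : {mpoly R[m]}) : {poly R} := mmap (@polyC R) (fun j => f j *: 'X) P.

(* The component J_{1,q} of J = ker(R[Y] -> R[ft]). *)
Definition rees_1q (k : fieldType) (n m : nat) (R : comAlgType k)
    (pi : {mpoly k[n.+1]} -> R) (f : 'I_m.+1 -> R) (q : nat)
    (P : {mpoly R[m.+1]}) : Prop :=
  [/\ rees_map f P = 0, P \is q.-homog & forall mu, form pi 1 P@_mu].

Definition rees_1_ideal (k : fieldType) (n m : nat) (R : comAlgType k)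
    (pi : {mpoly k[n.+1]} -> R) (f : 'I_m.+1 -> R) :
    {mpoly R[m.+1]} -> Prop :=
  ideal_gen (fun P => exists q, rees_1q pi f q P).

Definition minimal_generators (A : comNzRingType) (I : A -> Prop) (s : nat)
    (g : 'I_s -> A) : Prop :=
  (forall x, I x <-> family_ideal g x) /\
  (forall i, ~ ideal_gen (fun x => exists2 j, j != i & x = g j) (g i)).

(* k[X,Y] is encoded as k[X][Y]. *)
Definition bihomog (k : fieldType) (n m : nat) (d q : nat)
    (P : {mpoly {mpoly k[n]}[m]}) : Prop :=
  P \is q.-homog /\ forall mu, P@_mu \is d.-homog.

(* dP/dX_j for P of X-degree 1. The derivatives of the coefficients are then
   constants, identified with elements of k by taking constant terms. *)
Definition dX (k : fieldType) (n m : nat) (j : 'I_n)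
    (P : {mpoly {mpoly k[n]}[m]}) : {mpoly k[m]} :=
  map_mpoly (fun c : {mpoly k[n]} => (c^`M(j))@_0%MM) P.

Definition jacobian_dual_matrix (k : fieldType) (n m : nat)
    (a : {mpoly k[n.+1]} -> Prop)
    (R : comAlgType k) (pi : {rmorphism {mpoly k[n.+1]} -> R})
    (S : comAlgType k) (sigma : {mpoly k[m.+1]} -> S)
    (f : 'I_m.+1 -> R) (r s : nat) (psi : 'M[S]_(r + s, n.+1)) : Prop :=
  exists (l : 'I_r -> {mpoly k[n.+1]})
         (P : 'I_s -> {mpoly {mpoly k[n.+1]}[m.+1]}) (q : 'I_s -> nat),
    [/\ is_basis (linear_part a) l,
        forall i, bihomog 1 (q i) (P i),
        minimal_generators (rees_1_ideal pi f) (fun i => map_mpoly pi (P i))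
      & psi = col_mx (\matrix_(i < r, j < n.+1) sigma (dX j (l i)%:MP))
                     (\matrix_(i < s, j < n.+1) sigma (dX j (P i)))].

Definition is_jdrank (k : fieldType) (n m : nat)
    (a : {mpoly k[n.+1]} -> Prop)
    (R : comAlgType k) (pi : {rmorphism {mpoly k[n.+1]} -> R})
    (S : comAlgType k) (sigma : {mpoly k[m.+1]} -> S)
    (FF : ('I_m.+1 -> R) -> Prop) (rho : nat) : Prop :=
  exists (f : 'I_m.+1 -> R) (r s : nat) (psi : 'M[S]_(r + s, n.+1)),
    [/\ FF f, jacobian_dual_matrix a pi sigma f psi & has_rank psi rho].

Definition has_jdrank (k : fieldType) (n m : nat)
    (a : {mpoly k[n.+1]} -> Prop)
    (R : comAlgType k) (pi : {rmorphism {mpoly k[n.+1]} -> R})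
    (S : comAlgType k) (sigma : {mpoly k[m.+1]} -> S)
    (FF : ('I_m.+1 -> R) -> Prop) : Prop :=
  exists rho, is_jdrank a pi sigma FF rho.

Definition jdrank (k : fieldType) (n m : nat)
    (a : {mpoly k[n.+1]} -> Prop)
    (R : comAlgType k) (pi : {rmorphism {mpoly k[n.+1]} -> R})
    (S : comAlgType k) (sigma : {mpoly k[m.+1]} -> S)
    (FF : ('I_m.+1 -> R) -> Prop) : nat :=
  the_nat (is_jdrank a pi sigma FF).

Definition jdrank_plus (k : fieldType) (n m : nat)
    (a : {mpoly k[n.+1]} -> Prop)
    (R : comAlgType k) (pi : {rmorphism {mpoly k[n.+1]} -> R})
    (S : comAlgType k) (sigma : {mpoly k[m.+1]} -> S)
    (FF : ('I_m.+1 -> R) -> Prop) : int :=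
  (jdrank a pi sigma FF)%:Z - (dgi a)%:Z.

(* Main.v *)
From Stdlib Require ClassicalEpsilon.
From HB Require Import structures.
From mathcomp Require Import all_boot all_order all_algebra.
From mathcomp Require Import generic_quotient ring_quotient.
From mathcomp Require Import boolp ring zify.
From mathcomp Require classical_sets.
Require Import Defs.

Set Implicit Arguments.
Unset Strict Implicit.
Unset Printing Implicit Defensive.

Import GRing.Theory.
Local Open Scope ring_scope.

(* The bottom P of a longest chain of primes of R is a minimal prime, and
   elements separating the consecutive primes of the chain are algebraically
   independent modulo P. Let L be the fraction field of R/P, K the subfield
   generated by the images of the g_j, for g the representative that gives the
   Jacobian dual matrix psi. A regular element of S = k[g] stays regular in R,
   hence is not in P, so psi has a nonzero minor of size rho = jdrank over K.
   As psi kills the column (x_0, ..., x_n), Cramer's rule expresses the x_i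
   linearly over K in terms of n + 1 - rho of them; and since a nonzero g_j in
   K is a form of positive degree in the x_i, the ratios of these to one of
   them already generate L algebraically over K. Thus dim R is at most
   n - rho + trdeg K. Finally trdeg K <= dim S, since in a finitely generated
   algebra a prime modulo which t elements are algebraically independent starts
   a chain of length t. *)

(** * Ideals, and primes avoiding a multiplicative set *)

Lemma ideal_add (A : comNzRingType) (I : A -> Prop) x y :
  is_ideal I -> I x -> I y -> I (x + y).
Proof. by case=> _ D _; apply: D. Qed.

Lemma ideal_mull (A : comNzRingType) (I : A -> Prop) a x :
  is_ideal I -> I x -> I (a * x).
Proof. by case=> _ _; apply. Qed.

Lemma ideal_opp (A : comNzRingType) (I : A -> Prop) x :
  is_ideal I -> I x -> I (- x).
Proof. by rewrite -mulN1r => idI; apply: ideal_mull. Qed.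

Lemma ideal_sum (A : comNzRingType) (I : A -> Prop) (J : Type) (r : seq J)
    (D : pred J) (F : J -> A) :
  is_ideal I -> (forall j, D j -> I (F j)) -> I (\sum_(j <- r | D j) F j).
Proof.
by move=> idI IF; elim/big_ind: _ => [|x y|//]; [case: idI | exact: ideal_add].
Qed.

(** Zorn's lemma gives an ideal maximal among those containing [I] and disjoint from [T]. If it
    contained a product but neither factor, adjoining either factor would produce an element of [T],
    and the product of these two elements would lie in both the ideal and [T]. *)
Lemma prime_avoiding (A : comNzRingType) (I T : A -> Prop) :
    is_ideal I -> T 1 -> (forall x y, T x -> T y -> T (x * y)) ->
    (forall x, I x -> ~ T x) ->
  exists Q, [/\ prime_ideal Q, subideal I Q & forall x, Q x -> ~ T x].
Proof.
move=> idI T1 TM IT.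
pose good (J : A -> Prop) :=
  [/\ is_ideal J, subideal I J & forall x, J x -> ~ T x].
have goodI : good I by split.
(* Zorn's lemma is applied to sets that may be empty, so that the empty chain
   has an upper bound. *)
pose G (J : A -> Prop) := (forall x, ~ J x) \/ good J.
case: (@classical_sets.Zorn_bigcup A G) => [F FG Ftot|Q [GQ Qmax]].
  have [[J0 FJ0 gJ0]|noJ] := pselect (exists2 J, F J & good J); last first.
    left=> x [J FJ Jx]; case: (FG J FJ) => [/(_ x)//|gJ].
    by apply: noJ; exists J.
  right; split; last first.
  - move=> x [J FJ Jx]; case: (FG J FJ) => [/(_ x)//|[_ _ JT]]; exact: JT.
  - by move=> x Ix; exists J0 => //; case: gJ0 => _ IJ _; apply: IJ.
  split.
  - by exists J0 => //; case: gJ0 => [[]].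
  - move=> x y [J FJ Jx] [K FK Ky].
    have [JK|KJ] := Ftot _ _ FJ FK.
      case: (FG K FK) => [/(_ y)//|[idK _ _]].
      by exists K => //; apply: ideal_add => //; apply: JK.
    case: (FG J FJ) => [/(_ x)//|[idJ _ _]].
    by exists J => //; apply: ideal_add => //; apply: KJ.
  - move=> b x [J FJ Jx]; case: (FG J FJ) => [/(_ x)//|[idJ _ _]].
    by exists J => //; apply: ideal_mull.
have Qgood : good Q.
  case: GQ => // Q0; exfalso; apply: (Qmax I); last by right.
  by split=> [x /Q0//|] /(_ 0) IQ; apply/(Q0 0)/IQ; case: idI.
have [idQ IQ QT] := Qgood.
exists Q; split=> //; split=> // [Q1|x y Qxy]; first exact: (QT 1).
have enlarge z : ~ Q z -> exists q c, Q q /\ T (q + c * z).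
  move=> nQz; apply: contrapT => noT.
  apply: (Qmax (fun w => exists q c, Q q /\ w = q + c * z)).
    split=> [w Qw|/(_ z) Qz]; first by exists w, 0; rewrite mul0r addr0.
    apply/nQz/Qz; exists 0, 1; rewrite add0r mul1r.
    by split=> //; case: idQ.
  right; split.
  - split; first by exists 0, 0; rewrite mul0r addr0; split=> //; case: idQ.
      move=> _ _ [q [c [Qq ->]]] [q' [c' [Qq' ->]]].
      exists (q + q'), (c + c'); split; first exact: ideal_add.
      by rewrite mulrDl addrACA.
    move=> b _ [q [c [Qq ->]]]; exists (b * q), (b * c).
    by rewrite mulrDr mulrA; split=> //; apply: ideal_mull.
  - by move=> w /IQ Qw; exists w, 0; rewrite mul0r addr0.
  - by move=> _ [q [c [Qq ->]]] Tw; apply: noT; exists q, c.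
apply: contrapT => /not_orP[].
move=> /enlarge[q [c [Qq Tq]]] /enlarge[q' [c' [Qq' Tq']]].
apply: (QT _ _ (TM _ _ Tq Tq')).
rewrite mulrDl; apply: ideal_add => //.
  by rewrite mulrC; apply: ideal_mull.
rewrite mulrDr; apply: ideal_add => //; first exact: ideal_mull.
by rewrite mulrACA; apply: ideal_mull.
Qed.

(** * The fraction field of the quotient by a prime ideal *)

Section ResidueField.

Variables (A : comNzRingType) (P : A -> Prop) (prP : prime_ideal P).

Let Pb : {pred A} := fun x => `[< P x >].

Let Pb_idealr : idealr_closed Pb.
Proof.
have [idP P1 _] := prP.
split.
- by apply/asboolP; case: idP.
- by apply/asboolP.
- move=> b x y /asboolP Px /asboolP Py; apply/asboolP.
  by apply: ideal_add => //; apply: ideal_mull.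
Qed.

Let Pb_prime : prime_idealr_closed Pb.
Proof.
have [_ _ prM] := prP.
move=> x y /asboolP /prM[Px|Py]; apply/orP; [left|right]; exact/asboolP.
Qed.

HB.instance Definition _ := isIdealr.Build A Pb Pb_idealr.
HB.instance Definition _ := isPrimeIdealrClosed.Build A Pb Pb_prime.

Local Notation Q := {ideal_quot Pb}.

(** Forming [{fraction Q}] asks for an integral domain equipped with a boolean unit test and an
    inverse; both are supplied classically. *)
Let unitQ : pred Q := fun x => `[< exists y, y * x = 1 >].
Let invQ (x : Q) : Q :=
  if pselect (exists y, y * x = 1) is left h then projT1 (cid h) else x.

Let mulVQ : {in unitQ, left_inverse 1 invQ *%R}.
Proof.
move=> x /asboolP ux; rewrite /invQ; case: pselect => // h.
by case: (cid h).
Qed.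

Let unitQP x y : y * x = 1 -> unitQ x.
Proof. by move=> yx; apply/asboolP; exists y. Qed.

Let invQ_out : {in [predC unitQ], invQ =1 id}.
Proof.
move=> x; rewrite inE => /negP nx; rewrite /invQ; case: pselect => // h.
by case: nx; apply/asboolP.
Qed.

HB.instance Definition _ :=
  GRing.ComNzRing_hasMulInverse.Build Q mulVQ unitQP invQ_out.
HB.instance Definition _ :=
  GRing.ComUnitRing_isIntegral.Build Q (@Quotient.rquot_IdomainAxiom A Pb).

Lemma residue_field :
  exists (L : fieldType) (phi : {rmorphism A -> L}),
    forall x, phi x = 0 <-> P x.
Proof.
exists {fraction Q}, (@FracField.tofrac Q \o (\pi_Q)%qT) => x /=.
split=> [/eqP|Px]; last apply/eqP.
  rewrite tofrac_eq0 -(rmorph0 (\pi_Q)%qT) -Quotient.idealrBE subr0.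
  by move/asboolP.
rewrite tofrac_eq0 -(rmorph0 (\pi_Q)%qT) -Quotient.idealrBE subr0.
exact/asboolP.
Qed.

End ResidueField.

(** The products of powers of [b] with elements outside [P] are nonzero because [b] is regular. A
    prime avoiding them lies inside [P], so equals [P] by minimality, and it misses [b]. *)
Lemma minimal_prime_regular (A : comNzRingType) (P : A -> Prop) b :
  minimal_prime P -> GRing.lreg b -> ~ P b.
Proof.
move=> [prP Pmin] regb Pb; have [idP P1 PM] := prP.
pose T x := exists c e, ~ P c /\ x = c * b ^+ e.
have [||||Q [prQ _ QT]] := @prime_avoiding A (fun x => x = 0) T.
- by split=> [//|x y -> ->|c x ->]; rewrite ?addr0 ?mulr0.
- by exists 1, 0%N; rewrite mulr1.
- move=> _ _ [c [e [Pc ->]]] [c' [e' [Pc' ->]]]; exists (c * c'), (e + e')%N.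
  by rewrite exprD mulrACA; split=> // /PM[].
- move=> _ -> [c [e [Pc /esym/eqP]]]; rewrite mulrC.
  elim: e => [|e IHe].
    by rewrite mul1r => /eqP c0; apply: Pc; rewrite c0; case: idP.
  rewrite exprS -mulrA -[0](mulr0 b) => /eqP/regb/eqP; exact: IHe.
have QP : subideal Q P.
  move=> x Qx; apply: contrapT => nPx; apply: (QT x) => //.
  by exists x, 0%N; rewrite mulr1.
apply: (QT b); first exact: (Pmin Q).
by exists 1, 1%N; rewrite mul1r.
Qed.

(** * Subrings as predicates, and polynomials with coefficients in them *)

Definition is_subring (A : nzRingType) (W : A -> Prop) : Prop :=
  [/\ W 1, forall x y, W x -> W y -> W (x - y)
    & forall x y, W x -> W y -> W (x * y)].

Section Subring.

Variables (A : nzRingType) (W : A -> Prop) (ringW : is_subring W).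

Lemma subring1 : W 1. Proof. by case: ringW. Qed.

Lemma subringB x y : W x -> W y -> W (x - y).
Proof. by case: ringW => _ B _; apply: B. Qed.

Lemma subringM x y : W x -> W y -> W (x * y).
Proof. by case: ringW => _ _; apply. Qed.

Lemma subring0 : W 0.
Proof. by rewrite -(subrr 1); apply: subringB; apply: subring1. Qed.

Lemma subringN x : W x -> W (- x).
Proof. by rewrite -sub0r; apply: subringB; apply: subring0. Qed.

Lemma subringD x y : W x -> W y -> W (x + y).
Proof. by move=> Wx Wy; rewrite -[y]opprK; apply/subringB/subringN. Qed.

Lemma subringX x e : W x -> W (x ^+ e).
Proof.
move=> Wx; elim: e => [|e IHe]; first exact: subring1.
by rewrite exprS; apply: subringM.
Qed.

Lemma subring_sum (I : Type) (r : seq I) (D : pred I) (F : I -> A) :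
  (forall i, D i -> W (F i)) -> W (\sum_(i <- r | D i) F i).
Proof.
by move=> WF; elim/big_ind: _ => //; [apply: subring0 | apply: subringD].
Qed.

Lemma subring_prod (I : Type) (r : seq I) (D : pred I) (F : I -> A) :
  (forall i, D i -> W (F i)) -> W (\prod_(i <- r | D i) F i).
Proof.
by move=> WF; elim/big_ind: _ => //; [apply: subring1 | apply: subringM].
Qed.

End Subring.

Definition poly_in (A : nzRingType) (W : A -> Prop) (p : {poly A}) : Prop :=
  forall i, W p`_i.

Lemma poly_in_subring (A : nzRingType) (W : A -> Prop) :
  is_subring W -> is_subring (poly_in W).
Proof.
move=> ringW; split=> [i|p q Wp Wq i|p q Wp Wq i].
- by rewrite coef1; case: eqP => _; [apply: subring1 | apply: subring0].
- by rewrite coefB; apply: subringB.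
- by rewrite coefM; apply: subring_sum => // j _; apply: subringM.
Qed.

Lemma poly_inC (A : nzRingType) (W : A -> Prop) c :
  is_subring W -> W c -> poly_in W c%:P.
Proof. by move=> ringW Wc [|i]; rewrite coefC //=; apply: subring0. Qed.

Lemma poly_inX (A : nzRingType) (W : A -> Prop) :
  is_subring W -> poly_in W 'X.
Proof.
move=> ringW i; rewrite coefX.
by case: eqP => _; [apply: subring1 | apply: subring0].
Qed.

Lemma poly_in_horner (A : nzRingType) (W V : A -> Prop) p x :
  is_subring V -> (forall y, W y -> V y) -> V x -> poly_in W p -> V p.[x].
Proof.
move=> ringV WV Vx Wp; rewrite horner_coef; apply: subring_sum => // i _.
by apply: subringM => //; [apply/WV/Wp | apply: subringX].
Qed.

Lemma poly_in_lift (A B : nzRingType) (W : A -> Prop) (V : B -> Prop)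
    (phi : {rmorphism A -> B}) (p : {poly B}) :
    (forall y, V y -> exists2 x, W x & phi x = y) -> is_subring W ->
  poly_in V p -> exists2 q, poly_in W q & map_poly phi q = p.
Proof.
move=> liftV ringW Vp.
have /choice[c cP] i : exists x, W x /\ phi x = p`_i.
  by have [x Wx xE] := liftV _ (Vp i); exists x.
exists (\poly_(i < size p) c i).
  move=> i; rewrite coef_poly.
  by case: ifP => _; [case: (cP i) | apply: subring0].
apply/polyP=> i; rewrite coef_map coef_poly; case: ltnP => [_|le_p_i].
  by case: (cP i).
by rewrite nth_default // raddf0.
Qed.

(** * Integral and algebraic elements over a subring of a field *)

Section Integral.

Variables (L : fieldType).

Definition integral_over (W : L -> Prop) (x : L) : Prop :=
  exists p : {poly L}, [/\ p \is monic, poly_in W p & root p x].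

Section SubringType.

Variables (W : L -> Prop) (ringW : is_subring W).

Let Wb : {pred L} := fun x => `[< W x >].

Let Wb_subring : subring_closed Wb.
Proof.
split; first exact/asboolP/(subring1 ringW).
  by move=> x y /asboolP Wx /asboolP Wy; apply/asboolP/(subringB ringW).
by move=> x y /asboolP Wx /asboolP Wy; apply/asboolP/(subringM ringW).
Qed.

HB.instance Definition _ := GRing.isSubringClosed.Build L Wb Wb_subring.

(** Turning the predicate [W] into a ring type gives access to the closure and transitivity results
    for [integralOver]. *)
Record subring_type := SubringType { subring_val : L; _ : Wb subring_val }.

HB.instance Definition _ := [isSub for subring_val].
HB.instance Definition _ := [Choice of subring_type by <:].
HB.instance Definition _ :=
  [SubChoice_isSubComNzRing of subring_type by <:].

Lemma integral_overE x : integral_over W x <->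
  integralOver (val : subring_type -> L) x.
Proof.
split=> [[p [mon_p Wp px0]]|[p mon_p px0]].
  have [||q _ qE] :=
    @poly_in_lift subring_type L (fun=> True) W (val : subring_type -> L)
      p _ _ Wp.
  - by move=> y /asboolP Wy; exists (SubringType Wy).
  - by split.
  exists q; last by rewrite qE.
  rewrite monicE; apply/eqP/val_inj; move: mon_p; rewrite monicE -qE => /eqP.
  by rewrite (lead_coef_map_inj val_inj (raddf0 _)) rmorph1.
exists (map_poly val p); split=> // [|i]; first exact: monic_map.
by rewrite coef_map /=; case: (p`_i) => y /= /asboolP.
Qed.

Lemma integral_over_subring : is_subring (integral_over W).
Proof.
split.
- exact/integral_overE/integral1.
- move=> x y /integral_overE ? /integral_overE ?.
  exact/integral_overE/integral_sub.
- move=> x y /integral_overE ? /integral_overE ?.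
  exact/integral_overE/integral_mul.
Qed.

Lemma integral_over_trans x :
  integral_over (integral_over W) x -> integral_over W x.
Proof.
move=> [p [mon_p Wp px0]]; apply/integral_overE.
apply: (integral_root_monic mon_p px0).
by apply/integral_poly=> i; apply/integral_overE/Wp.
Qed.

End SubringType.

Lemma integral_over_mem (W : L -> Prop) x :
  is_subring W -> W x -> integral_over W x.
Proof.
move=> ringW Wx; exists ('X - x%:P); rewrite monicXsubC root_XsubC eqxx.
split=> //; apply: (subringB (poly_in_subring ringW)); first exact: poly_inX.
exact: poly_inC.
Qed.

Definition algebraic_over (W : L -> Prop) (x : L) : Prop :=
  exists p : {poly L}, [/\ p != 0, poly_in W p & root p x].

Definition fractions (W : L -> Prop) (x : L) : Prop :=
  exists a b, [/\ W a, W b, b != 0 & x = a / b].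

Section Algebraic.

Variables (W : L -> Prop) (ringW : is_subring W).

Lemma fractions_subring : is_subring (fractions W).
Proof.
split.
- by exists 1, 1; rewrite oner_neq0 divr1; split=> //; apply: subring1.
- move=> _ _ [a [b [Wa Wb b0 ->]]] [c [d [Wc Wd d0 ->]]].
  exists (a * d - c * b), (b * d); rewrite mulf_neq0 //; split=> //.
  - by apply: subringB => //; apply: subringM.
  - exact: subringM.
  - by rewrite -[in LHS]mulNr addf_div // mulNr.
- move=> _ _ [a [b [Wa Wb b0 ->]]] [c [d [Wc Wd d0 ->]]].
  exists (a * c), (b * d); rewrite mulf_neq0 // mulf_div.
  by split=> //; apply: subringM.
Qed.

Lemma fractions_mem x : W x -> fractions W x.
Proof.
by exists x, 1; rewrite oner_neq0 divr1; split=> //; apply: subring1.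
Qed.

Lemma common_denominator N (c : nat -> L) : (forall i, fractions W (c i)) ->
  exists b, [/\ W b, b != 0 & forall i, (i < N)%N -> W (b * c i)].
Proof.
move=> Fc; elim: N => [|N [b [Wb b0 bP]]].
  by exists 1; rewrite oner_neq0; split=> //; apply: subring1.
have [a [d [Wa Wd d0 cE]]] := Fc N.
exists (d * b); rewrite mulf_neq0 //; split=> //; first exact: subringM.
move=> i; rewrite ltnS leq_eqVlt => /predU1P[->|lt_i_N].
  by rewrite cE mulrAC mulrCA divff // mulr1 mulrC; apply: subringM.
by rewrite -mulrA; apply: subringM => //; apply: bP.
Qed.

(** Dividing by the leading coefficient makes an equation monic; conversely a common denominator
    clears its coefficients. Facts on integral elements thereby carry over to algebraic ones. *)
Lemma algebraic_overE x :
  algebraic_over W x <-> integral_over (fractions W) x.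
Proof.
split=> [[p [p0 Wp px0]]|[p [mon_p Fp px0]]].
  have lc0 : lead_coef p != 0 by rewrite lead_coef_eq0.
  exists ((lead_coef p)^-1 *: p); split.
  - by rewrite monicE lead_coefZ mulVf.
  - move=> i; rewrite coefZ mulrC; exists p`_i, (lead_coef p).
    by split=> //; apply: Wp.
  - by rewrite rootE hornerZ (rootP px0) mulr0.
have [b [Wb b0 bP]] := common_denominator (size p) Fp.
exists (b *: p); split.
- by rewrite scaler_eq0 negb_or b0 monic_neq0.
- move=> i; rewrite coefZ; case: (ltnP i (size p)) => [/bP//|le_p_i].
  by rewrite nth_default // mulr0; apply: subring0.
- by rewrite rootE hornerZ (rootP px0) mulr0.
Qed.

Lemma algebraic_over_subring : is_subring (algebraic_over W).
Proof.
have [F1 FB FM] := integral_over_subring fractions_subring.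
split; first exact/algebraic_overE.
  by move=> x y /algebraic_overE ? /algebraic_overE ?; apply/algebraic_overE/FB.
by move=> x y /algebraic_overE ? /algebraic_overE ?; apply/algebraic_overE/FM.
Qed.

Lemma algebraic_over_mem x : W x -> algebraic_over W x.
Proof.
move=> Wx; apply/algebraic_overE/integral_over_mem.
  exact: fractions_subring.
exact: fractions_mem.
Qed.

Lemma algebraic_over_inv x : algebraic_over W x -> algebraic_over W x^-1.
Proof.
have [->|x0] := eqVneq x 0; first by rewrite invr0.
move=> [p [p0 Wp px0]].
have p_gt0 : (0 < size p)%N by rewrite size_poly_gt0.
(* The reversed polynomial vanishes at the inverse; its constant term, the leading coefficient of
   [p], keeps it nonzero. *)
exists (\poly_(i < size p) p`_((size p).-1 - i)); split.
- apply/negP=> /eqP /polyP /(_ 0); rewrite coef_poly p_gt0 subn0 coef0.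
  by apply/eqP; rewrite lead_coef_eq0.
- move=> i; rewrite coef_poly; case: ifP => _ //; exact: subring0.
rewrite rootE horner_poly.
rewrite -(inj_eq (mulfI (expf_neq0 (size p).-1 x0))) mulr0.
apply/eqP; transitivity p.[x]; last exact/rootP.
rewrite mulr_sumr horner_coef [RHS](reindex_inj rev_ord_inj) /=.
apply: eq_bigr => i _; have le_i_p : (i <= (size p).-1)%N.
  by rewrite -ltnS prednK.
have -> : (size p - i.+1 = (size p).-1 - i)%N by rewrite subnS -!subn1 subnAC.
rewrite mulrCA exprVn; congr (_ * _).
by rewrite -{1}(subnK le_i_p) exprD mulfK ?expf_neq0.
Qed.

(** The elements algebraic over [W] are closed under inverses, so the equation can be made monic,
    and transitivity of integrality over the fractions of [W] applies. *)
Lemma algebraic_over_trans x :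
  algebraic_over (algebraic_over W) x -> algebraic_over W x.
Proof.
have ringF := fractions_subring; have ringZ := algebraic_over_subring.
move=> [p [p0 Wp px0]]; apply/algebraic_overE/(integral_over_trans ringF).
exists ((lead_coef p)^-1 *: p); split.
- by rewrite monicE lead_coefZ mulVf // lead_coef_eq0.
- move=> i; rewrite coefZ; apply/algebraic_overE; apply: subringM => //.
  exact/algebraic_over_inv/Wp.
- by rewrite rootE hornerZ (rootP px0) mulr0.
Qed.

End Algebraic.

Lemma algebraic_over_sub (W V : L -> Prop) x :
  (forall y, W y -> V y) -> algebraic_over W x -> algebraic_over V x.
Proof. by move=> WV [p [p0 Wp px0]]; exists p; split=> // i; apply/WV/Wp. Qed.

Definition adjoin1 (A : nzRingType) (W : A -> Prop) (y x : A) : Prop :=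
  exists2 p, poly_in W p & x = p.[y].

(* A nonzero bivariate polynomial over W killing (x, y) is read as a polynomial
   in x and, after exchanging the variables, as one in y. *)
Lemma algebraic_over_exchange (W : L -> Prop) x y : is_subring W ->
    algebraic_over (adjoin1 W y) x -> ~ algebraic_over W x ->
  algebraic_over (adjoin1 W x) y.
Proof.
move=> ringW [p [p0 Wp px0]] nWx.
have /choice[c cP] i : exists q, poly_in W q /\ p`_i = q.[y].
  by have [q] := Wp i; exists q.
pose P := \poly_(i < size p) c i; pose Q := swapXY P.
have Wcoef i j : W P`_i`_j.
  rewrite coef_poly; case: ifP => _; last by rewrite coef0; apply: subring0.
  by case: (cP i).
have PE : map_poly (horner_eval y) P = p.
  apply/polyP=> i; rewrite coef_map coef_poly; case: ltnP => [_|le_p_i].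
    by case: (cP i).
  by rewrite raddf0 nth_default.
exists (map_poly (horner_eval x) Q); split.
(* If specialization at [x] killed [Q], any nonzero coefficient of [Q], a polynomial over [W], would
   make [x] algebraic over [W]. *)
- apply: contra_not_neq nWx => Q0.
  have [i pi0] : exists i, Q`_i != 0.
    apply: contrapT => noi; case/eqP: p0; rewrite -PE -[P]swapXYK -/Q.
    suff -> : Q = 0 by rewrite !raddf0.
    apply/polyP=> i; rewrite coef0; apply/eqP; apply: contrapT => Qi.
    by apply: noi; exists i; apply/negP.
  exists Q`_i; split=> // [j|]; first by rewrite coef_swapXY.
  by rewrite rootE -[_.[x]]/(horner_eval x Q`_i) -coef_map Q0 coef0.
- move=> i; rewrite coef_map; exists Q`_i => //= j.
  by rewrite coef_swapXY.
- rewrite rootE -[X in _.[X]](hornerC y x) horner_map /=.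
  rewrite /horner_eval horner2_swapXY.
  move: px0; rewrite -PE rootE -{1}(hornerC x y) -[_.[y]]/(horner_eval y _).
  by rewrite horner_map.
Qed.

End Integral.

(** * Finitely generated subalgebras *)

Section Adjoin.

Variables (k : fieldType) (A : comNzRingType) (iota : {rmorphism k -> A}).

(* k[s] *)
Fixpoint adjoin (s : seq A) : A -> Prop :=
  if s is y :: s' then adjoin1 (adjoin s') y else fun x => exists c, x = iota c.

Lemma adjoin1_subring (W : A -> Prop) y :
  is_subring W -> is_subring (adjoin1 W y).
Proof.
move=> ringW; have ringP := poly_in_subring ringW; split.
- by exists 1; [apply: (subring1 ringP) | rewrite hornerC].
- move=> _ _ [p Wp ->] [q Wq ->]; exists (p - q); last by rewrite !hornerE.
  exact: (subringB ringP).
- move=> _ _ [p Wp ->] [q Wq ->]; exists (p * q); last by rewrite !hornerE.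
  exact: (subringM ringP).
Qed.

Lemma adjoin_subring s : is_subring (adjoin s).
Proof.
elim: s => [|y s IHs]; last exact: adjoin1_subring.
split; first by exists 1; rewrite rmorph1.
- by move=> _ _ [a ->] [b ->]; exists (a - b); rewrite rmorphB.
- by move=> _ _ [a ->] [b ->]; exists (a * b); rewrite rmorphM.
Qed.

Lemma adjoin_cons y s x : adjoin s x -> adjoin (y :: s) x.
Proof.
move=> sx; exists x%:P; last by rewrite hornerC.
exact: (poly_inC (adjoin_subring s)).
Qed.

Lemma adjoin_base s c : adjoin s (iota c).
Proof. by elim: s => [|y s IHs]; [exists c | apply: adjoin_cons]. Qed.

Lemma adjoin_mem s x : x \in s -> adjoin s x.
Proof.
elim: s => //= y s IHs; rewrite inE => /predU1P[->|/IHs sx].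
  by exists 'X; [apply: (poly_inX (adjoin_subring s)) | rewrite hornerX].
exact: adjoin_cons.
Qed.

Lemma adjoin_min (W : A -> Prop) s : is_subring W -> (forall c, W (iota c)) ->
  (forall y, y \in s -> W y) -> forall x, adjoin s x -> W x.
Proof.
move=> ringW Wk; elim: s => [|y s IHs] Ws x /= [].
  by move=> c ->.
move=> p sp ->; apply: poly_in_horner sp => //; last first.
  by apply: Ws; rewrite mem_head.
by apply: IHs => z sz; apply: Ws; rewrite inE sz orbT.
Qed.

End Adjoin.

Section AdjoinMap.

Variables (k : fieldType) (A B : comNzRingType).
Variables (iota : {rmorphism k -> A}) (phi : {rmorphism A -> B}).

Lemma adjoin_map_lift s y : adjoin (phi \o iota) (map phi s) y ->
  exists2 x, adjoin iota s x & phi x = y.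
Proof.
elim: s y => [|z s IHs] y /= [].
  by move=> c ->; exists (iota c) => //; exists c.
move=> p sp ->; have [q sq <-] := poly_in_lift IHs (adjoin_subring _ _) sp.
by exists q.[z]; [exists q | rewrite horner_map].
Qed.

Lemma adjoin_map s x :
  adjoin iota s x -> adjoin (phi \o iota) (map phi s) (phi x).
Proof.
elim: s x => [|z s IHs] x /= [].
  by move=> c ->; exists c.
move=> p sp ->; exists (map_poly phi p); last by rewrite horner_map.
by move=> i; rewrite coef_map; apply/IHs/sp.
Qed.

Lemma adjoin_poly_lift s p :
  poly_in (adjoin (phi \o iota) (map phi s)) p ->
  exists2 q, poly_in (adjoin iota s) q & map_poly phi q = p.
Proof. exact: (poly_in_lift (@adjoin_map_lift s) (adjoin_subring _ _)). Qed.

End AdjoinMap.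

(** * Algebraic dependence as a matroid *)

Section Matroid.

Variables (k L : fieldType) (iota : {rmorphism k -> L}).

(** The algebraic closure of k(s) in [L]; algebraicity over the ring k[s] defines the same
    elements. *)
Definition acl (s : seq L) : L -> Prop := algebraic_over (adjoin iota s).

Lemma acl_subring s : is_subring (acl s).
Proof. exact/algebraic_over_subring/adjoin_subring. Qed.

Lemma acl_adjoin s x : adjoin iota s x -> acl s x.
Proof. exact/algebraic_over_mem/adjoin_subring. Qed.

Lemma acl_mem s x : x \in s -> acl s x.
Proof. by move/(adjoin_mem iota)/acl_adjoin. Qed.

Lemma acl_inv s x : acl s x -> acl s x^-1.
Proof. exact/algebraic_over_inv/adjoin_subring. Qed.

Lemma acl_algebraic s x : algebraic_over (acl s) x -> acl s x.
Proof. exact/algebraic_over_trans/adjoin_subring. Qed.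

Lemma acl_adjoin_trans s s' x :
  (forall y, y \in s -> acl s' y) -> adjoin iota s x -> acl s' x.
Proof.
move=> ss'; apply: adjoin_min ss' x; first exact: acl_subring.
by move=> c; apply/acl_adjoin/adjoin_base.
Qed.

Lemma acl_trans s s' x : (forall y, y \in s -> acl s' y) -> acl s x -> acl s' x.
Proof.
move=> ss' sx; apply: acl_algebraic; apply: algebraic_over_sub sx => y.
exact: acl_adjoin_trans.
Qed.

Lemma acl_sub s s' x : {subset s <= s'} -> acl s x -> acl s' x.
Proof. by move=> ss'; apply: acl_trans => y /ss'; apply: acl_mem. Qed.

Lemma acl_exchange s x y : acl (y :: s) x -> ~ acl s x -> acl (x :: s) y.
Proof. exact/algebraic_over_exchange/adjoin_subring. Qed.

(** Algebraic independence over k in triangular form: each entry is transcendental over the later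
    ones. *)
Fixpoint indep (s : seq L) : Prop :=
  if s is x :: s' then ~ acl s' x /\ indep s' else True.

(** Entries of [w] join [s] starting from the right; [b] is the one at which [x] becomes dependent,
    hence the one that can be exchanged for [x]. *)
Lemma acl_first_dependent w s x : ~ acl s x -> acl (w ++ s) x ->
  exists q b p, [/\ w = q ++ b :: p, acl (b :: p ++ s) x & ~ acl (p ++ s) x].
Proof.
elim: w => [//|b w IHw] nsx wx.
have [/(IHw nsx)[q [c [p [-> cx ncx]]]]|nwx] := pselect (acl (w ++ s) x).
  by exists (b :: q), c, p.
by exists [::], b, w.
Qed.

(** The entries of [z] replace entries of [w] one by one in a spanning sequence of constant length;
    the exchange property recovers each discarded entry. *)
Lemma steinitz_exchange z w : indep z -> (forall x, x \in z -> acl w x) ->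
  exists2 w', (size z + size w')%N = size w &
    forall x, x \in w -> acl (w' ++ z) x.
Proof.
elim: z => [|x z IHz].
  by exists w => // x; rewrite cats0; apply: acl_mem.
move=> [nzx indz] zw.
have [|w' sizew' ww'] := IHz indz.
  by move=> y zy; apply: zw; rewrite inE zy orbT.
have w'x : acl (w' ++ z) x by apply: acl_trans (zw x (mem_head _ _)).
have [q [b [p [wE bx nbx]]]] := acl_first_dependent nzx w'x.
exists (q ++ p); first by rewrite -sizew' wE !size_cat /= !addnS addSn.
move=> y /ww'; apply: acl_trans => u; have [->|ub] := eqVneq u b.
  move=> _; apply: (@acl_sub (x :: p ++ z)); last exact: acl_exchange.
  by move=> v; rewrite !(inE, mem_cat) => /or3P[] ->; rewrite ?orbT.
rewrite wE !(inE, mem_cat) (negbTE ub) /= => zu; apply: acl_mem.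
by rewrite !(inE, mem_cat) orbCA zu orbT.
Qed.

Lemma indep_size z w :
  indep z -> (forall x, x \in z -> acl w x) -> (size z <= size w)%N.
Proof. by move=> indz /(steinitz_exchange indz)[w' <- _]; apply: leq_addr. Qed.

Lemma indep_basis (w : seq L) : exists2 z : seq L, indep z &
  {subset z <= w} /\ forall x, x \in w -> acl z x.
Proof.
elim: w => [|y w [z indz [zw wz]]]; first by exists [::].
have [zy|nzy] := pselect (acl z y).
  exists z => //; split=> [x /zw|x]; rewrite inE; first by move->; rewrite orbT.
  by case/predU1P=> [->|/wz].
exists (y :: z) => //; split=> x; rewrite !inE.
  by case/predU1P=> [->|/zw ->]; rewrite ?eqxx ?orbT.
case/predU1P=> [->|/wz]; first by apply: acl_mem; rewrite mem_head.
by apply: acl_sub => u zu; rewrite inE zu orbT.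
Qed.

(** The new entries go behind [y], so that [y] stays transcendental over all of them. Exchange
    ensures this: if [z] made [y] dependent, [z] would already depend on [y] and the rest. *)
Lemma indep_extend y s (w : seq L) : indep (y :: s) ->
  exists u : seq L, [/\ {subset u <= w}, indep (y :: u ++ s)
    & forall x, x \in w -> acl (y :: u ++ s) x].
Proof.
move=> indy; elim: w => [|z w [u [uw [nuy indu] wu]]]; first by exists [::].
have uzw : {subset u <= z :: w} by move=> x /uw; rewrite inE orbC => ->.
have [uz|nuz] := pselect (acl (y :: u ++ s) z).
  by exists u; split=> // x; rewrite inE => /predU1P[->|/wu].
have sub_zu t : acl (u ++ s) t -> acl (y :: u ++ s) t.
  by apply: acl_sub => v uv; rewrite inE uv orbT.
exists (z :: u); split=> [x||x].
- by rewrite inE => /predU1P[->|/uzw//]; rewrite mem_head.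
- split; first by move=> zy; apply: nuz; apply: acl_exchange.
  by split=> //; move/sub_zu.
rewrite inE => /predU1P[->|/wu].
  by apply: acl_mem; rewrite !inE eqxx orbT.
by apply: acl_sub => v; rewrite !inE => /predU1P[->|->]; rewrite ?eqxx ?orbT.
Qed.

End Matroid.

(** * Algebraic independence modulo a prime, and chains of primes *)

Section IndependenceModuloPrime.

Variables (k : fieldType) (A : comNzRingType) (iota : {rmorphism k -> A}).

(** Algebraic independence of the residues in A/P, phrased inside [A] so that [P] can vary;
    [indep_modP] translates it to the residue field. *)
Fixpoint indep_mod (P : A -> Prop) (s : seq A) : Prop :=
  if s is x :: s' then
    (forall p, poly_in (adjoin iota s') p -> P p.[x] -> poly_in P p) /\
    indep_mod P s'
  else True.

Lemma prime_base (P : A -> Prop) c : prime_ideal P -> P (iota c) -> c = 0.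
Proof.
move=> [idP P1 _] Pc; have [//|c0] := eqVneq c 0; case: P1.
by rewrite -(rmorph1 iota) -(mulVf c0) rmorphM; apply: ideal_mull.
Qed.

Lemma ideal_horner (I : A -> Prop) p x : is_ideal I -> poly_in I p -> I p.[x].
Proof.
move=> idI Ip; rewrite horner_coef; apply: ideal_sum => // i _.
by rewrite mulrC; apply: ideal_mull.
Qed.

(** Unfolding an element of k[s] that lies in [Q] variable by variable, all its coefficients lie in
    [Q], down to scalars, which must be 0. What is built from them lies in every prime. *)
Lemma indep_mod_adjoin (P Q : A -> Prop) s : prime_ideal P -> prime_ideal Q ->
  indep_mod Q s -> forall x, adjoin iota s x -> Q x -> P x.
Proof.
move=> prP prQ; have [[P0 _ _] _ _] := prP.
elim: s => [_ x [c ->] /(prime_base prQ) ->|]; first by rewrite rmorph0.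
move=> x s IHs [xQ indQ] _ [p sp ->] /(xQ _ sp) Qp.
have [idP _ _] := prP; apply: ideal_horner => // i.
exact: IHs (sp i) (Qp i).
Qed.

(* Divide p by the largest power of x: this needs x not in P. Its new constant
   term lies in Q because x does. *)
Lemma indep_mod_cons (P Q : A -> Prop) x s : prime_ideal P -> prime_ideal Q ->
  subideal P Q -> Q x -> ~ P x -> indep_mod Q s -> indep_mod P (x :: s).
Proof.
move=> prP prQ PQ Qx nPx indQ; have [idP _ PM] := prP; have [idQ _ _] := prQ.
have QP := indep_mod_adjoin prP prQ indQ.
split; last first.
  elim: s {QP} indQ (QP) => //= y s IHs [yQ indQ] QP; split.
    move=> p sp Pp i; apply: QP; first exact/adjoin_cons/sp.
    by apply: yQ => //; apply: PQ.
  by apply: IHs => // z sz; apply/QP/adjoin_cons.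
move=> p sp Ppx; elim: {p}(size p) {-2}p (leqnn (size p)) sp Ppx => [|N IHN] p.
  rewrite leqn0 size_poly_eq0 => /eqP -> _ _ i.
  by rewrite coef0; case: idP.
move: p; elim/poly_ind => [|p c _].
  by move=> _ _ _ i; rewrite coef0; case: idP.
move=> le_p_N sp; rewrite hornerMXaddC => Ppx.
have sp' : poly_in (adjoin iota s) p.
  by move=> i; have := sp i.+1; rewrite coefD coefMX coefC addr0.
have sc : adjoin iota s c by have := sp 0; rewrite coefD coefMX coefC add0r.
have Pc : P c.
  apply: QP => //; rewrite -[c](addKr (p.[x] * x)).
  apply: ideal_add => //; last exact: PQ.
  by apply: ideal_opp => //; apply: ideal_mull.
have Pp : P p.[x].
  have : P (p.[x] * x).
    by rewrite -[_ * x](addrK c); apply: ideal_add => //; apply: ideal_opp.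
  by case/PM.
have Pp' : poly_in P p.
  apply: IHN => //; move: le_p_N; rewrite size_MXaddC.
  by case: eqP => [->|_]; rewrite ?size_poly0.
move=> [|i]; rewrite coefD coefMX coefC ?add0r //= addr0; exact: Pp'.
Qed.

(** The sequence grows from the top of the chain downwards: an element of [c 1] outside [c 0] is
    prepended to a sequence independent modulo [c 1]. *)
Lemma prime_chain_indep e (c : nat -> A -> Prop) :
    (forall i, (i <= e)%N -> prime_ideal (c i)) ->
    (forall i, (i < e)%N ->
       subideal (c i) (c i.+1) /\ ~ subideal (c i.+1) (c i)) ->
  exists2 s, size s = e & indep_mod (c 0%N) s.
Proof.
elim: e c => [|e IHe] c prc incc; first by exists [::].
have [||s sizes inds] := IHe (fun i => c i.+1).
- by move=> i le_i_e; apply: prc.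
- by move=> i lt_i_e; apply: incc.
have [sub01 nsub10] := incc 0%N isT.
have [x c1x nc0x] : exists2 x, c 1%N x & ~ c 0%N x.
  apply: contrapT => nox; apply: nsub10 => x c1x; apply: contrapT => nc0x.
  by apply: nox; exists x.
exists (x :: s); rewrite /= ?sizes //.
by apply: indep_mod_cons c1x _ _ => //; apply: prc.
Qed.

Lemma indep_mod_sub (P Q : A -> Prop) s : subideal P Q -> indep_mod P s ->
  (forall x, adjoin iota s x -> Q x -> P x) -> indep_mod Q s.
Proof.
move=> PQ; elim: s => //= y s IHs [yP indP] QP; split=> [p sp Qp i|].
  by apply/PQ/(yP p) => //; apply: QP => //; exists p.
by apply: IHs => // x sx; apply/QP/adjoin_cons.
Qed.

Variables (L : fieldType) (phi : {rmorphism A -> L}) (P : A -> Prop).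
Hypothesis kerP : forall x, phi x = 0 <-> P x.

Lemma indep_modP s : indep_mod P s <-> indep (phi \o iota) (map phi s).
Proof.
elim: s => //= x s IHs; split=> -[xP inds]; split; try exact/IHs.
  move=> [p [p0 sp]]; have [q sq qE] := adjoin_poly_lift sp.
  rewrite -qE rootE horner_map => /eqP/kerP /(xP q sq) Pq.
  case/eqP: p0; rewrite -qE; apply/polyP=> i; rewrite coef_map coef0.
  exact/kerP.
move=> p sp /kerP pPx i; apply/kerP; apply: contrapT => pi0; apply: xP.
exists (map_poly phi p); split.
- apply/eqP=> /polyP/(_ i); rewrite coef_map coef0; exact: pi0.
- by move=> j; rewrite coef_map; apply: adjoin_map.
- by rewrite rootE horner_map pPx.
Qed.

End IndependenceModuloPrime.

(** * Localization at one element and integral dependence *)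

Section Localization.

Variable (L : fieldType).

Definition localized (W : L -> Prop) (h x : L) : Prop :=
  exists a e, W a /\ x = a / h ^+ e.

Lemma localized_subring (W : L -> Prop) h :
  is_subring W -> W h -> h != 0 -> is_subring (localized W h).
Proof.
move=> ringW Wh h0; split.
- by exists 1, 0%N; rewrite divr1; split=> //; apply: subring1.
- move=> _ _ [a [e [Wa ->]]] [b [f [Wb ->]]].
  exists (a * h ^+ f - b * h ^+ e), (e + f)%N.
  split; first by apply: subringB => //; apply: subringM => //; apply: subringX.
  by rewrite -[in LHS]mulNr addf_div ?expf_neq0 // mulNr exprD.
- move=> _ _ [a [e [Wa ->]]] [b [f [Wb ->]]]; exists (a * b), (e + f)%N.
  by rewrite mulf_div exprD; split=> //; apply: subringM.
Qed.

Lemma localized_mem (W : L -> Prop) h x : W x -> localized W h x.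
Proof. by move=> Wx; exists x, 0%N; rewrite divr1. Qed.

Lemma localized_sub (W : L -> Prop) h h' x : is_subring W -> W h' -> h' != 0 ->
  localized W h x -> localized W (h * h') x.
Proof.
move=> ringW Wh' h'0 [a [e [Wa ->]]]; exists (a * h' ^+ e), e.
split; first by apply: subringM => //; apply: subringX.
by rewrite exprMn -mulf_div divff ?expf_neq0 // mulr1.
Qed.

Lemma integral_over_sub (W V : L -> Prop) x :
  (forall y, W y -> V y) -> integral_over W x -> integral_over V x.
Proof. by move=> WV [p [p0 Wp px0]]; exists p; split=> // i; apply/WV/Wp. Qed.

(** The product of the leading coefficients of equations for the entries of [s] serves as [h]. *)
Lemma algebraic_integral_localized (W : L -> Prop) (s : seq L) : is_subring W ->
    (forall x, x \in s -> algebraic_over W x) ->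
  exists2 h, W h /\ h != 0 &
    forall x, x \in s -> integral_over (localized W h) x.
Proof.
move=> ringW; elim: s => [|y s IHs] sW.
  by exists 1 => //; rewrite oner_neq0; split=> //; apply: subring1.
have [|h [Wh h0] hP] := IHs.
  by move=> x sx; apply: sW; rewrite inE sx orbT.
have [p [p0 Wp py0]] := sW y (mem_head _ _).
have lc0 : lead_coef p != 0 by rewrite lead_coef_eq0.
have Wlc : W (lead_coef p) by apply: Wp.
exists (h * lead_coef p).
  by rewrite mulf_neq0 //; split=> //; apply: subringM.
move=> x; rewrite inE => /predU1P[->|/hP]; last first.
  by apply: integral_over_sub => z; apply: localized_sub.
exists ((lead_coef p)^-1 *: p); split.
- by rewrite monicE lead_coefZ mulVf.
(* The quotient of a coefficient by the leading one is expanded by [h] to have the required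
   denominator. *)
- move=> i; rewrite coefZ; exists (h * p`_i), 1%N; split; first exact: subringM.
  by rewrite -mulf_div divff // mul1r mulrC.
- by rewrite rootE hornerZ (rootP py0) mulr0.
Qed.

(** Multiplying an integral equation of [b] of degree e by g^e turns powers of [b] into powers of
    [v], and every term but the leading one keeps a factor [g]. *)
Lemma integral_dvd_power (W : L -> Prop) g b v : is_subring W -> W g -> W v ->
  v = g * b -> integral_over W b -> exists e d, W d /\ v ^+ e = g * d.
Proof.
move=> ringW Wg Wv vE [p [mon_p Wp pb0]]; have p_gt0 := monic_neq0 mon_p.
rewrite -size_poly_gt0 in p_gt0; have pE := prednK p_gt0.
set e := (size p).-1 in pE.
exists e, (- \sum_(i < e) p`_i * v ^+ i * g ^+ (e - i.+1)); split.
  apply: subringN => //; apply: subring_sum => // i _.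
  by apply: subringM => //; [apply: subringM => //|]; apply: subringX.
move/rootP: pb0; rewrite horner_coef -pE big_ord_recr /=.
have -> : p`_e = 1 by apply/eqP; rewrite -monicE.
rewrite mul1r => /(congr1 ( *%R (g ^+ e))); rewrite mulr0 mulrDr -exprMn -vE.
move/eqP; rewrite addrC addr_eq0 => /eqP ->; rewrite mulrN; congr (- _).
rewrite !mulr_sumr; apply: eq_bigr => i _.
have -> : g ^+ e = g * g ^+ i * g ^+ (e - i.+1) by rewrite -exprS -exprD subnKC.
by rewrite vE exprMn; ring.
Qed.

End Localization.

(** * Krull dimension of finitely generated algebras *)

Section FinitelyGenerated.

Variables (k : fieldType) (A : comNzRingType) (iota : {rmorphism k -> A}).
Variables (gens : seq A) (gensP : forall x, adjoin iota gens x).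

Lemma indep_mod_cat P u s : indep_mod iota P (u ++ s) -> indep_mod iota P s.
Proof. by elim: u => //= x u IHu []. Qed.

Lemma map_sub_lift (T U : eqType) (phi : T -> U) (s : seq T) (u : seq U) :
  {subset u <= map phi s} -> exists u', u = map phi u'.
Proof.
elim: u => [|x u IHu] us; first by exists [::].
have [|u' ->] := IHu; first by move=> y uy; apply: us; rewrite inE uy orbT.
by have /mapP[x' _ ->] := us x (mem_head _ _); exists (x' :: u').
Qed.

(* Enlarge s so that A is algebraic over k[y, s] modulo P. Then A is integral
   over k[y, s][1/h] for some h in k[y, s]; a prime containing 1 + y h and
   avoiding the products of powers of h and nonzero elements of k[s] exists,
   as 1 + y h is coprime to h and of positive degree in y. *)
Lemma prime_enlarge (P : A -> Prop) y s : prime_ideal P ->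
    indep_mod iota P (y :: s) ->
  exists Q,
    [/\ prime_ideal Q, subideal P Q, ~ subideal Q P & indep_mod iota Q s].
Proof.
move=> prP; have [idP P1 PM] := prP.
have [L [phi kerP]] := residue_field prP.
move=> /(indep_modP iota kerP)/(indep_extend (map phi gens)).
move=> [u0 [/map_sub_lift[u ->]]] /=; rewrite -map_cat; set t := u ++ s.
set j := (phi \o iota); set Y := phi y.
move=> [nYt indt] gensY; pose C0 := adjoin j (map phi t).
have ringC0 : is_subring C0 := adjoin_subring _ _.
pose C1 := adjoin1 C0 Y.
have ringC1 : is_subring C1 := adjoin1_subring _ ringC0.
have [H [[h C0h HE] H0] Hint] := algebraic_integral_localized ringC1 gensY.
have [hA tA hAE] := adjoin_poly_lift C0h.
have phih : phi hA.[y] = H by rewrite HE -hAE horner_map.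
have h0 : h != 0 by apply: contra_neq H0 => h0; rewrite HE h0 horner0.
(* [Y] is transcendental over [C0], so identities between values at [Y] lift to polynomials. *)
have transY p : poly_in C0 p -> p.[Y] = 0 -> p = 0.
  move=> C0p pY0; apply: contrapT => /eqP p0; apply: nYt.
  by exists p; split=> //; apply/rootP.
pose g := 1 + y * hA.[y]; pose gp := 1 + 'X * h.
have C0gp : poly_in C0 gp.
  have ringP := poly_in_subring ringC0.
  apply: (subringD ringP); first exact: (subring1 ringP).
  by apply: (subringM ringP) => //; apply: poly_inX.
have gpY : gp.[Y] = phi g.
  by rewrite !hornerE -HE -phih rmorphD rmorphM rmorph1.
have size_gp : (1 < size gp)%N.
  rewrite /gp addrC mulrC size_MXaddC (negbTE h0) /=.
  by rewrite ltnS size_poly_gt0.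
pose T x := exists M c, [/\ adjoin iota t c, ~ P c & x = hA.[y] ^+ M * c].
pose I x := exists q b, P q /\ x = q + g * b.
have idI : is_ideal I.
  split.
  - by exists 0, 0; rewrite mulr0 addr0; split=> //; case: idP.
  - move=> _ _ [q [b [Pq ->]]] [q' [b' [Pq' ->]]]; exists (q + q'), (b + b').
    by rewrite mulrDr addrACA; split=> //; apply: ideal_add.
  - move=> c _ [q [b [Pq ->]]]; exists (c * q), (c * b).
    by rewrite mulrDr mulrCA; split=> //; apply: ideal_mull.
have [||x [q [b [Pq ->]]] [M [c [tc nPc qE]]]|Q [prQ IQ QT]] :=
  prime_avoiding idI (T := T).
- exists 0%N, 1; rewrite mul1r; split=> //.
  exact: subring1 (adjoin_subring _ _).
- move=> _ _ [M [c [tc nPc ->]]] [M' [c' [tc' nPc' ->]]].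
  exists (M + M')%N, (c * c'); rewrite exprD mulrACA; split=> //.
    exact: subringM (adjoin_subring _ _) _ _ tc tc'.
  by case/PM.
(* An element of [T] in P + (g) would make H^M c a multiple of [g] by an element integral over [D].
   A power of it is then a multiple within [D], and clearing denominators gives h^N c^e = gp pa as
   polynomials. Being coprime to [h], [gp] would divide a nonzero constant. *)
- pose D := localized C1 H.
  have C1H : C1 H by exists h.
  have ringD : is_subring D by apply: localized_subring.
  have C0C1 z : C0 z -> C1 z.
    by move=> C0z; exists z%:P; [apply: poly_inC | rewrite hornerC].
  have Dc : D (phi c) by apply/localized_mem/C0C1/adjoin_map.
  have U0 : phi c != 0 by apply/eqP=> /kerP.
  have DH : D H by apply: localized_mem.
  have Dg : D (phi g) by apply: localized_mem; exists gp.
  have intb : integral_over D (phi b).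
    suff : forall z, adjoin iota gens z -> integral_over D (phi z) by apply.
    have [i1 iB iM] := integral_over_subring ringD.
    apply: (@adjoin_min _ _ _ (fun z => integral_over D (phi z))).
    - split; first by rewrite rmorph1.
        by move=> z z'; rewrite rmorphB; apply: iB.
      by move=> z z'; rewrite rmorphM; apply: iM.
    - move=> a; apply: integral_over_mem => //; apply/localized_mem/C0C1.
      exact: (adjoin_base j).
    - by move=> z gz; apply/Hint/map_f.
  have vE : H ^+ M * phi c = phi g * phi b.
    rewrite -phih -rmorphXn -!rmorphM -qE rmorphD.
    by have /kerP -> := Pq; rewrite add0r.
  have Dv : D (H ^+ M * phi c) by apply: subringM => //; apply: subringX.
  have [e [_ [[a [f [[pa C0a ->] ->]]]]]] :=
    integral_dvd_power ringD Dg Dv vE intb.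
  move=> /(congr1 ( *%R^~ (H ^+ f))); rewrite mulrA mulfVK ?expf_neq0 //.
  rewrite exprMn -exprM mulrAC -exprD; set N := (_ + f)%N => HNE.
  have pE : h ^+ N * (phi c ^+ e)%:P = gp * pa.
    apply/eqP; rewrite -subr_eq0; apply/eqP/transY; last first.
      by rewrite hornerD hornerN !hornerM horner_exp hornerC -HE HNE gpY subrr.
    have ringP := poly_in_subring ringC0.
    apply: (subringB ringP); apply: (subringM ringP) => //.
      exact: (subringX ringP).
    by apply: poly_inC => //; apply: subringX => //; apply: adjoin_map.
  have gp_dvd : gp %| (phi c ^+ e)%:P.
    have cop : coprimep gp (h ^+ N).
      rewrite coprimep_expr // coprimep_sym; apply/Bezout_eq1_coprimepP.
      by exists (- 'X, 1) => /=; rewrite mul1r /gp mulNr addrC addrK.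
    by rewrite -(Gauss_dvdpr _ cop) pE dvdp_mulr.
  have := dvdp_leq _ gp_dvd; rewrite polyC_eq0 expf_neq0 // => /(_ isT).
  by rewrite size_polyC expf_neq0 // leqNgt size_gp.
exists Q; have PQ : subideal P Q.
  by move=> x Px; apply: IQ; exists x, 0; rewrite mulr0 addr0.
split=> //.
  move=> /(_ g) QP; have : P g.
    apply/QP/IQ; exists 0, 1; rewrite add0r mulr1.
    by split=> //; case: idP.
  move/kerP; rewrite -gpY => /(transY _ C0gp) gp0.
  by move: size_gp; rewrite gp0 size_poly0.
(* Elements of k[t] outside [P] belong to [T], with exponent 0, so [Q] adds nothing to [P] on
   k[t]. *)
apply: (@indep_mod_cat Q u); apply: indep_mod_sub PQ _ _.
  exact/(indep_modP iota kerP).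
move=> x tx Qx; apply: contrapT => nPx; apply: (QT x) => //.
by exists 0%N, x; rewrite mul1r.
Qed.

Lemma indep_mod_prime_chain (P : A -> Prop) s : prime_ideal P ->
  indep_mod iota P s -> prime_chain A (size s).
Proof.
move=> prP inds.
suff [c [_ prc incc]] : exists c : nat -> A -> Prop,
    [/\ c 0%N = P, forall i, (i <= size s)%N -> prime_ideal (c i)
      & forall i, (i < size s)%N ->
          subideal (c i) (c i.+1) /\ ~ subideal (c i.+1) (c i)].
  by exists c.
elim: s P prP inds => [|y s IHs] P prP inds; first by exists (fun=> P).
have [Q [prQ PQ nQP indQ]] := prime_enlarge prP inds.
have [c [c0 prc incc]] := IHs Q prQ indQ.
exists (fun i => if i is i'.+1 then c i' else P); split=> // -[|i] //=.
- exact: prc.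
- by rewrite c0.
- exact: incc.
Qed.

Lemma prime_chain_bounded e : prime_chain A e -> (e <= size gens)%N.
Proof.
move=> [c [prc incc]]; have [s <- inds] := prime_chain_indep iota prc incc.
have [L [phi kerP]] := residue_field (prc 0%N isT).
rewrite -(size_map phi s) -(size_map phi gens).
apply: (@indep_size _ _ (phi \o iota)); first exact/(indep_modP iota kerP).
by move=> _ /mapP[x _ ->]; apply/acl_adjoin/adjoin_map.
Qed.

(** As [krull_dim] is an epsilon choice, a longest chain must be shown to exist: some prime exists
    because 1 is not 0, and chain lengths are bounded by the number of generators. *)
Lemma krull_dimP : prime_chain A (krull_dim A) /\
  forall e, prime_chain A e -> (e <= krull_dim A)%N.
Proof.
apply: (@ClassicalEpsilon.epsilon_spec nat (inhabits 0%N)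
  (fun d => prime_chain A d /\ forall e, prime_chain A e -> (e <= d)%N)).
have chain0 : exists d, `[< prime_chain A d >].
  have [||||Q [prQ _ _]] :=
      @prime_avoiding A (fun x => x = 0) (fun x => x = 1).
  - by split=> [//|x y -> ->|c x ->]; rewrite ?addr0 ?mulr0.
  - by [].
  - by move=> x y -> ->; rewrite mulr1.
  - by move=> x -> /eqP; rewrite eq_sym oner_eq0.
  by exists 0%N; apply/asboolP; exists (fun=> Q).
have bounded d : `[< prime_chain A d >] -> (d <= size gens)%N.
  by move/asboolP/prime_chain_bounded.
case: (ex_maxnP chain0 bounded) => d /asboolP chaind dmax.
by exists d; split=> // e chaine; apply/dmax/asboolP.
Qed.

Lemma krull_dim_indep (P : A -> Prop) s : prime_ideal P ->
  indep_mod iota P s -> (size s <= krull_dim A)%N.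
Proof.
by move=> prP inds; apply: krull_dimP.2; apply: indep_mod_prime_chain inds.
Qed.

(** A prime strictly below the bottom of a longest chain would lengthen it. *)
Lemma krull_dim_minimal_prime :
  exists P s, [/\ minimal_prime P, indep_mod iota P s & size s = krull_dim A].
Proof.
have [[c [prc incc]] dimmax] := krull_dimP.
have [s sizes inds] := prime_chain_indep iota prc incc.
exists (c 0%N), s; split=> //; split=> [|Q prQ Qc0]; first exact: prc.
apply: contrapT => nc0Q.
suff /dimmax : prime_chain A (krull_dim A).+1 by rewrite ltnn.
by exists (fun i => if i is i'.+1 then c i' else Q); split=> [] [|i] //=;
  [apply: prc | apply: incc].
Qed.

End FinitelyGenerated.

(** * Evaluation of homogeneous polynomials *)

Lemma mmap1_scale n (A : comNzRingType) (x : 'I_n -> A) c m :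
  mmap1 (fun i => c * x i) m = c ^+ mdeg m * mmap1 x m.
Proof.
rewrite /mmap1 mdegE -prodrXr -big_split /=.
by apply: eq_bigr => i _; rewrite exprMn.
Qed.

Lemma mmap_homog_scale n (K A : comNzRingType) (h : {rmorphism K -> A})
    (x : 'I_n -> A) c d p : p \is d.-homog ->
  mmap h (fun i => c * x i) p = c ^+ d * mmap h x p.
Proof.
move=> /dhomogP hom_p; rewrite /mmap mulr_sumr !big_seq.
by apply: eq_bigr => m /hom_p <-; rewrite mmap1_scale mulrCA.
Qed.

Lemma mmap_in_subring n (K A : comNzRingType) (h : {rmorphism K -> A})
    (x : 'I_n -> A) (W : A -> Prop) p : is_subring W ->
  (forall c, W (h c)) -> (forall i, W (x i)) -> W (mmap h x p).
Proof.
move=> ringW Wh Wx; apply: subring_sum => // m _; apply: subringM => //.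
by apply: subring_prod => // i _; apply: subringX.
Qed.

Lemma linear_form_sum n (k : fieldType) (p : {mpoly k[n]}) :
  p \is 1.-homog -> p = \sum_j p@_U_(j) *: 'X_j.
Proof.
move=> hom_p; apply/mpolyP=> m; rewrite raddf_sum /=.
under eq_bigr do rewrite mcoeffZ mcoeffX.
have [/eqP/mdeg1P[i /eqP ->]|m1] := eqVneq (mdeg m) 1%N.
  rewrite (bigD1 i) //= eqxx mulr1 big1 ?addr0 // => j /negbTE ji.
  by rewrite eq_mnm1 ji mulr0.
rewrite (dhomog_nemf_coeff hom_p) // big1 // => j _.
by case: eqP => [mE|]; rewrite ?mulr0 //; case/eqP: m1; rewrite -mE mdeg1.
Qed.

(** * Cramer's rule with values in a module *)

Section FieldRank.

Variables (L : fieldType) (Z V : L -> Prop).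
Hypotheses (ringZ : is_subring Z) (V0 : V 0).
Hypotheses (VD : forall x y, V x -> V y -> V (x + y)).
Hypotheses (VZ : forall a x, Z a -> V x -> V (a * x)).

Lemma det_in_subring n (N : 'M[L]_n) : (forall i j, Z (N i j)) -> Z (\det N).
Proof.
move=> ZN; apply: subring_sum => // s _; apply: subringM => //.
  by apply: subringX => //; apply: subringN => //; apply: subring1.
exact: subring_prod.
Qed.

Lemma module_sum (I : Type) (r : seq I) (D : pred I) (F : I -> L) :
  (forall i, D i -> V (F i)) -> V (\sum_(i <- r | D i) F i).
Proof. by move=> VF; elim/big_ind: _. Qed.

(** Moving the columns outside the minor to the other side puts N t in [V], and the adjugate of N
    isolates the entries of t. This serves with [V] zero and with [V] equal to [Z]. *)
Lemma cramer_in_module p n rho (M : 'M[L]_(p, n)) (t : 'I_n -> L)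
    (u : 'I_rho -> 'I_p) (v : 'I_rho -> 'I_n) :
    injective v -> (forall i j, Z (M i j)) ->
    (forall i, \sum_j M i j * t j = 0) ->
    (forall j, j \notin codom v -> V (t j)) ->
  forall l, V (\det (mxsub u v M) * t (v l)).
Proof.
move=> inj_v ZM Mt0 Vt l; set N := mxsub u v M.
have ZN i j : Z (N i j) by rewrite mxE.
have VN i : V (\sum_j N i j * t (v j)).
  have := Mt0 (u i).
  rewrite (bigID (mem (codom v))) /= -big_uniq /=; last first.
    by rewrite map_inj_uniq ?enum_uniq.
  rewrite big_image /= => /eqP; rewrite addr_eq0 => /eqP.
  have -> : \sum_j N i j * t (v j) = \sum_j M (u i) (v j) * t (v j).
    by apply: eq_bigr => j _; rewrite mxE.
  move=> ->; rewrite -mulN1r; apply: VZ.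
    by apply: subringN => //; apply: subring1.
  by apply: module_sum => j nvj; apply: VZ => //; apply: Vt.
have -> : \det N * t (v l) = \sum_i (\adj N) l i * \sum_j N i j * t (v j).
  transitivity ((\adj N *m N *m (\col_j t (v j))) l 0).
    by rewrite mul_adj_mx mul_scalar_mx !mxE.
  rewrite -mulmxA mxE; apply: eq_bigr => i _; rewrite [(_ *m _) i 0]mxE.
  congr (_ * _); apply: eq_bigr => j _; congr (_ * _).
  by rewrite mxE.
apply: module_sum => i _; apply: VZ => //; rewrite !mxE; apply: subringM => //.
  by apply: subringX => //; apply: subringN => //; apply: subring1.
by apply: det_in_subring => a b; rewrite !mxE.
Qed.

End FieldRank.

(** * Algebraic generators obtained from a nonzero minor *)

Section ProjectiveGenerators.

Variables (k L : fieldType) (iota : {rmorphism k -> L}) (n m p rho d : nat).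
Variables (x : 'I_n.+1 -> L) (g : 'I_m -> L) (F : 'I_m -> {mpoly k[n.+1]}).
Variables (M : 'M[L]_(p, n.+1)).
Variables (u : 'I_rho -> 'I_p) (v : 'I_rho -> 'I_n.+1).
Hypotheses (d_gt0 : (0 < d)%N) (homF : forall j, F j \is d.-homog).
Hypotheses (gE : forall j, g j = mmap iota x (F j)).
Hypotheses (gnz : exists j, g j != 0).
Hypotheses (gM : forall i j, adjoin iota (codom g) (M i j)).
Hypotheses (Mx0 : forall i, \sum_j M i j * x j = 0).
Hypotheses (minor0 : \det (mxsub u v M) != 0).

(** Columns are selected by an arbitrary map, but a repeated column would make the minor vanish. *)
Let inj_v : injective v.
Proof.
move=> i j vij; apply: contrapT => /eqP ij; case/eqP: minor0.
rewrite -det_tr; apply: (determinant_alternate ij) => l.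
by rewrite !mxE vij.
Qed.

(** Otherwise Cramer's rule would make all the x_j vanish, and with them every g_j, a form of
    positive degree in them. *)
Let exists_pivot : exists2 j, j \notin codom v & x j != 0.
Proof.
apply: contrapT => nopivot.
have x0 j : j \notin codom v -> x j = 0.
  move=> vj; apply: contrapT => /eqP xj; apply: nopivot; exists j => //.
have {}x0 j : x j = 0.
  have [/codomP[l ->]|/x0//] := boolP (j \in codom v).
  have /eqP : \det (mxsub u v M) * x (v l) = 0.
    apply: (@cramer_in_module L (adjoin iota (codom g)) (fun y => y = 0)) => //.
    - exact: adjoin_subring.
    - by move=> a b -> ->; rewrite addr0.
    - by move=> a b _ ->; rewrite mulr0.
  by rewrite mulf_eq0 (negbTE minor0) => /eqP.
have [j /eqP[]] := gnz; rewrite gE.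
rewrite -[x]/(fun i => x i) (_ : (fun i => x i) = fun i => 0 * x i).
  by rewrite (mmap_homog_scale _ _ _ (homF j)) expr0n gtn_eqF // mulr0n mul0r.
by apply: funext => i; rewrite x0 mulr0.
Qed.

(* With x_j0 nonzero and j0 outside the columns of the minor, the witnesses are
   the ratios x_j / x_j0 for the other such j. Cramer's rule puts all the ratios
   in acl, and g_j = x_j0 ^ d * F_j(x / x_j0) puts x_j0 there. *)
Lemma projective_generators :
  exists2 w, (size w + rho)%N = n & forall i, acl iota (codom g ++ w) (x i).
Proof.
have [j0 vj0 xj0] := exists_pivot.
pose E := enum [pred j | (j != j0) && (j \notin codom v)].
exists [seq x j / x j0 | j <- E].
  (* The n + 1 columns split into the [rho] columns of the minor, the pivot [j0] and those listed in
     [E]. *)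
  apply/eqP; rewrite -eqSS; apply/eqP; rewrite -addSn size_map -[RHS]card_ord.
  rewrite -(cardC (mem (codom v))) addnC; congr addn.
    by rewrite -[LHS]card_ord -(card_codom inj_v); apply: eq_card.
  rewrite (cardD1 j0) inE /= vj0 add1n; congr _.+1.
  by rewrite -cardE; apply: eq_card => j; rewrite !inE.
set w := map _ _; pose Z := acl iota (codom g ++ w).
have ringZ : is_subring Z := acl_subring _ _.
have Zg j : Z (g j) by apply: acl_mem; rewrite mem_cat codom_f.
have ZM i j : Z (M i j).
  apply: acl_adjoin_trans (gM i j) => y gy; apply: acl_mem.
  by rewrite mem_cat gy.
pose t j := x j / x j0.
have Zt j : j \notin codom v -> Z (t j).
  move=> vj; have [->|jj0] := eqVneq j j0.
    by rewrite /t divff //; apply: subring1.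
  by apply: acl_mem; rewrite mem_cat map_f ?orbT // mem_enum inE jj0.
have Mt0 i : \sum_j M i j * t j = 0.
  by under eq_bigr do rewrite mulrA; rewrite -mulr_suml Mx0 mul0r.
have {}Zt j : Z (t j).
  have [/codomP[l ->]|/Zt//] := boolP (j \in codom v).
  rewrite -(mulKf minor0 (t (v l))); apply: subringM => //.
    by apply: acl_inv; apply: (det_in_subring ringZ) => a b; rewrite mxE.
  apply: (@cramer_in_module L Z Z) => //; first exact: subring0.
    exact: subringD.
  exact: subringM.
suff Zx : Z (x j0).
  by move=> i; rewrite -(divfK xj0 (x i)); apply: subringM => //; apply: Zt.
have [j gj0] := gnz; pose c := mmap iota t (F j).
have gjE : g j = x j0 ^+ d * c.
  rewrite gE -(mmap_homog_scale _ _ _ (homF j)); congr mmap.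
  by apply: funext => i; rewrite mulrC divfK.
have c0 : c != 0 by apply: contra_neq gj0; rewrite gjE => ->; rewrite mulr0.
have Zc : Z c.
  apply: mmap_in_subring => // a; exact/acl_adjoin/adjoin_base.
apply: acl_algebraic; exists ('X^d - (g j / c)%:P); split.
- by rewrite -size_poly_gt0 size_XnsubC.
- have ringP := poly_in_subring ringZ; apply: (subringB ringP).
    by apply: (subringX ringP); apply: poly_inX.
  by apply: poly_inC => //; apply: subringM => //; apply: acl_inv.
- by rewrite rootE !hornerE gjE mulfK // subrr.
Qed.

End ProjectiveGenerators.

Lemma the_natP (D : nat -> Prop) : (exists d, D d) -> D (the_nat D).
Proof. exact: ClassicalEpsilon.epsilon_spec. Qed.

(** * Linear forms and the embedding dimension *)

Section LinearForms.

Variables (k : fieldType) (n : nat) (a : {mpoly k[n.+1]} -> Prop).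
Variables (R : comAlgType k) (pi : {lrmorphism {mpoly k[n.+1]} -> R}).
Hypothesis hR : is_quotient a pi.

(** Identifies row vectors with linear forms, so that dimensions of spaces of linear forms become
    matrix ranks. *)
Definition linear_form (v : 'rV[k]_n.+1) : {mpoly k[n.+1]} :=
  \sum_j v 0 j *: 'X_j.

Lemma linear_form_linear : linear linear_form.
Proof.
move=> c u v; rewrite /linear_form scaler_sumr -big_split /=.
by apply: eq_bigr => j _; rewrite !mxE scalerDl scalerA.
Qed.

HB.instance Definition _ :=
  GRing.isLinear.Build k 'rV[k]_n.+1 {mpoly k[n.+1]} _ linear_form
    linear_form_linear.

Lemma linear_form_homog v : linear_form v \is 1.-homog.
Proof. by apply: rpred_sum => j _; apply: rpredZ; rewrite dhomogX /= mdeg1. Qed.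

Lemma linear_formK v j : (linear_form v)@_U_(j) = v 0 j.
Proof.
rewrite raddf_sum (bigD1 j) //= big1 ?addr0 => [|i /negbTE ij].
  by rewrite mcoeffZ mcoeffX eqxx mulr1.
by rewrite mcoeffZ mcoeffX eq_mnm1 ij mulr0.
Qed.

Lemma linear_form_inj : injective linear_form.
Proof. by move=> u v uv; apply/rowP=> j; rewrite -!linear_formK uv. Qed.

Lemma linear_formP p : p \is 1.-homog -> exists v, p = linear_form v.
Proof.
move/linear_form_sum=> pE; exists (\row_j p@_U_(j)).
by rewrite {1}pE; apply: eq_bigr => j _; rewrite mxE.
Qed.

Lemma linear_form_mulmx r (c : 'rV_r) (B : 'M_(r, n.+1)) :
  linear_form (c *m B) = \sum_i c 0 i *: linear_form (row i B).
Proof.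
by rewrite mulmx_sum_row linear_sum; apply: eq_bigr => i _; rewrite linearZ.
Qed.

(** The coordinates of the basis are the rows of [A], whose row space is thus the kernel of [pi] in
    degree 1. *)
Lemma linear_part_basis_rows r (l : 'I_r -> {mpoly k[n.+1]}) :
    is_basis (linear_part a) l ->
  exists2 A : 'M_(r, n.+1), row_free A &
    forall v, pi (linear_form v) = 0 <-> (v <= A)%MS.
Proof.
move=> [la lspan lfree]; have [_ pi0] := hR.
have /choice[c cE] i : exists v, l i = linear_form v.
  by apply: linear_formP; case: (la i).
pose A := \matrix_i c i.
have lE (b : 'rV_r) : linear_form (b *m A) = \sum_i b 0 i *: l i.
  by rewrite linear_form_mulmx; apply: eq_bigr => i _; rewrite rowK cE.
exists A.
  apply: inj_row_free => b /(congr1 linear_form).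
  rewrite lE linear0 => /lfree b0.
  by apply/rowP=> i; rewrite b0 mxE.
move=> v; split=> [/pi0 av|/submxP[b ->]].
  have [|b bE] := lspan (linear_form v).
    by split=> //; apply: linear_form_homog.
  apply/submxP; exists (\row_i b i); apply: linear_form_inj.
  by rewrite lE bE; apply: eq_bigr => i _; rewrite mxE.
rewrite lE linear_sum big1 // => i _; rewrite linearZ /=.
by have [/pi0 -> _] := la i; rewrite scaler0.
Qed.

(** A basis of a complement of the row space of [A] maps to a basis of R_1. *)
Lemma form_basis_exists r (A : 'M[k]_(r, n.+1)) :
    (forall v, pi (linear_form v) = 0 <-> (v <= A)%MS) ->
  exists t (e : 'I_t -> R), is_basis (form pi 1) e.
Proof.
move=> piA; pose B := row_base A^C%MS.
exists _, (fun i => pi (linear_form (row i B))).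
have eE (b : 'rV_(\rank A^C%MS)) :
    pi (linear_form (b *m B)) = \sum_i b 0 i *: pi (linear_form (row i B)).
  rewrite linear_form_mulmx linear_sum; apply: eq_bigr => i _.
  by rewrite linearZ.
split.
- by move=> i; exists (linear_form (row i B)) => //; apply: linear_form_homog.
- move=> _ [p /linear_formP[v ->] <-].
  have : (v <= A + B)%MS.
    apply: submx_full; rewrite /row_full.
    rewrite (adds_eqmx (eqmx_refl A) (eq_row_base _)).
    exact: addsmx_compl_full.
  case/sub_addsmxP=> -[b c] ->; exists (fun i => c 0 i).
  rewrite linearD linearD -eE /=; have /piA -> := submxMl b A.
  by rewrite add0r.
- move=> c c0 i; pose b := \row_i c i.
  have : (b *m B <= A :&: A^C)%MS.
    rewrite sub_capmx; apply/andP; split.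
      apply/piA; rewrite eE -[RHS]c0.
      by apply: eq_bigr => j _; rewrite mxE.
    by rewrite -(eq_row_base A^C%MS) submxMl.
  rewrite capmx_compl submx0 => /eqP bB0.
  have : b = 0.
    by apply: (row_free_inj (row_base_free A^C%MS)); rewrite bB0 mul0mx.
  by move/rowP/(_ i); rewrite !mxE.
Qed.

(** Stacking [A] on the coordinates of lifts of [e] gives a matrix whose rows are independent and
    span everything, hence a square one. *)
Lemma form_basis_size r (A : 'M[k]_(r, n.+1)) t (e : 'I_t -> R) :
    row_free A -> (forall v, pi (linear_form v) = 0 <-> (v <= A)%MS) ->
  is_basis (form pi 1) e -> (r + t)%N = n.+1.
Proof.
move=> freeA piA [ef espan efree].
have /choice[c cE] i : exists v, e i = pi (linear_form v).
  by have [p /linear_formP[v ->] <-] := ef i; exists v.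
pose B := \matrix_i c i.
have eE (b : 'rV_t) : pi (linear_form (b *m B)) = \sum_i b 0 i *: e i.
  rewrite linear_form_mulmx linear_sum; apply: eq_bigr => i _.
  by rewrite linearZ rowK cE.
have : row_free (col_mx A B).
  apply: inj_row_free => v; rewrite -[v]hsubmxK mul_row_col => vAB.
  have v2 : rsubmx v = 0.
    apply/rowP=> i; rewrite [RHS]mxE; apply: (efree (fun i => rsubmx v 0 i)).
    rewrite -eE; move/eqP: vAB; rewrite addrC addr_eq0 => /eqP ->.
    by rewrite !linearN /=; have /piA -> := submxMl (lsubmx v) A; rewrite oppr0.
  move: vAB; rewrite v2 mul0mx addr0 -(mul0mx _ A) => /(row_free_inj freeA) ->.
  by rewrite row_mx0.
have : row_full (col_mx A B).
  rewrite -sub1mx; apply/row_subP=> i; set v := row i _.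
  have [|b bE] := espan (pi (linear_form v)).
    by exists (linear_form v) => //; apply: linear_form_homog.
  have : (v - (\row_i b i) *m B <= A)%MS.
    apply/piA; rewrite !linearB /= eE bE.
    apply/eqP; rewrite subr_eq0; apply/eqP.
    by apply: eq_bigr => j _; rewrite mxE.
  case/submxP=> c' /eqP; rewrite subr_eq => /eqP ->.
  by rewrite -mul_row_col submxMl.
by rewrite /row_full /row_free => /eqP -> /eqP.
Qed.

(** Both numbers are epsilon choices: [l] shows that the first is attained, and the complement
    construction does so for the second. *)
Lemma edim_dgi r (l : 'I_r -> {mpoly k[n.+1]}) :
  is_basis (linear_part a) l -> (dgi a + edim pi)%N = n.+1.
Proof.
move=> lbasis.
have [|l' l'basis] := @the_natP
  (fun r => exists l : 'I_r -> _, is_basis (linear_part a) l).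
  by exists r, l.
have [A freeA piA] := linear_part_basis_rows l'basis.
have [e ebasis] := the_natP (form_basis_exists piA).
exact: (form_basis_size freeA piA ebasis).
Qed.

End LinearForms.

(** * Evaluation of polynomials in an algebra *)

Section Evaluation.

Variables (k : fieldType) (m : nat) (R : comAlgType k) (f : 'I_m -> R).

Definition eval_rmorphism : {rmorphism {mpoly k[m]} -> R} := mmap (in_alg R) f.

Lemma eval_atB p q : eval_at f (p - q) = eval_at f p - eval_at f q.
Proof. exact: (rmorphB eval_rmorphism). Qed.

Lemma eval_atM p q : eval_at f (p * q) = eval_at f p * eval_at f q.
Proof. exact: (rmorphM eval_rmorphism). Qed.

Lemma eval_at1 : eval_at f 1 = 1.
Proof. exact: (rmorph1 eval_rmorphism). Qed.

Lemma eval_at_sum (I : Type) (r : seq I) (D : pred I) (F : I -> {mpoly k[m]}) :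
  eval_at f (\sum_(i <- r | D i) F i) = \sum_(i <- r | D i) eval_at f (F i).
Proof. exact: (raddf_sum eval_rmorphism). Qed.

Lemma eval_at_adjoin p : adjoin (in_alg R) (codom f) (eval_at f p).
Proof.
apply: mmap_in_subring; first exact: adjoin_subring.
  by move=> c; apply: adjoin_base.
by move=> i; apply/adjoin_mem/codom_f.
Qed.

Lemma rmorph_eval_at n (A : comAlgType k) (pi : {lrmorphism A -> R})
    (x : 'I_n -> A) p : pi (eval_at x p) = eval_at (fun i => pi (x i)) p.
Proof.
rewrite /eval_at /mmap rmorph_sum; apply: eq_bigr => mu _.
rewrite rmorphM /= linearZ /= rmorph1; congr (_ * _).
by rewrite /mmap1 rmorph_prod; apply: eq_bigr => i _; rewrite rmorphXn.
Qed.

Lemma eval_at_X (pi : {lrmorphism {mpoly k[m]} -> R}) p :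
  pi p = eval_at (fun i => pi 'X_i) p.
Proof.
rewrite -rmorph_eval_at; congr (pi _).
rewrite {1}[p]mpolyE; apply: eq_bigr => mu _.
by rewrite mmap1_id /= mulr_algl.
Qed.

Lemma quotient_adjoin (a : {mpoly k[m]} -> Prop)
    (pi : {lrmorphism {mpoly k[m]} -> R}) : is_quotient a pi ->
  forall y, adjoin (in_alg R) (codom (fun i => pi 'X_i)) y.
Proof.
move=> [surj _] y; have [p <-] := surj y; rewrite eval_at_X.
apply: mmap_in_subring; first exact: adjoin_subring.
  by move=> c; apply: adjoin_base.
by move=> i; apply: adjoin_mem; exact: (codom_f (fun i => pi 'X_i)).
Qed.

End Evaluation.

(** * Relations among the forms of a representative *)

Section Relations.

Variables (k : fieldType) (n m : nat) (a : {mpoly k[n.+1]} -> Prop).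
Variables (R : comAlgType k) (pi : {lrmorphism {mpoly k[n.+1]} -> R}).
Hypotheses (ha : homogeneous_ideal a) (hR : is_quotient a pi).

Lemma eval_at_homog d e (F : 'I_m -> {mpoly k[n.+1]}) p :
  (forall j, F j \is d.-homog) -> p \is e.-homog ->
  eval_at F p \is (d * e).-homog.
Proof.
move=> homF /dhomogP homp; rewrite /eval_at /mmap big_seq.
apply: rpred_sum => mu /homp <-; rewrite /= mulr_algl.
apply: rpredZ; rewrite mdegE big_distrr /= /mmap1.
elim/big_rec2: _ => [|j e' q _ homq]; first exact: dhomog1.
by apply: dhomogM => //; apply: dhomogMn.
Qed.

(** Substituting lifts of the f_j to forms of degree d sends the degree e component of [p] to degree
    d e, and the others elsewhere since d is positive. Homogeneity of [a] then separates the
    components. *)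
Lemma relations_homog d e (f : 'I_m -> R) p :
    (0 < d)%N -> (forall j, form pi d (f j)) -> relations f p ->
  relations f (pihomog mdeg e p).
Proof.
move=> d_gt0 formf; have [_ pi0] := hR; have [_ ha_homog] := ha.
have /choice[F FE] j : exists q, q \is d.-homog /\ pi q = f j.
  by have [q] := formf j; exists q.
have evalF q : eval_at f q = pi (eval_at F q).
  rewrite rmorph_eval_at; congr eval_at.
  by apply: funext => j; case: (FE j).
rewrite /relations !evalF => /pi0/(ha_homog _ (d * e)%N) aF; apply/pi0.
suff <- : pihomog mdeg (d * e) (eval_at F p) =
    eval_at F (pihomog mdeg e p) by [].
have homF q : eval_at F (pihomog mdeg q p) \is (d * q).-homog.
  by apply: eval_at_homog; [move=> j; case: (FE j) | apply: pihomogP].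
have le_p := leq_maxl (msize p) e.+1; have lt_e := leq_maxr (msize p) e.+1.
rewrite {1}(pihomog_partitionE le_p) eval_at_sum raddf_sum /=.
rewrite (bigD1 (Ordinal lt_e)) //= pihomog_dE // big1 ?addr0 // => i ie.
by apply: (@pihomog_ne0 _ _ _ (d * i)%N) => //; rewrite eqn_pmul2l.
Qed.

(** On a component of degree e, c'^e p(g) = p(c' g) = p(c f) = c^e p(f) = 0, and c'^e is regular.
    Hence equivalent representatives share the presentation of [S]. *)
Lemma relations_proportional d (f g : 'I_m -> R) c c' :
    (0 < d)%N -> (forall j, form pi d (f j)) -> GRing.lreg c' ->
    (forall j, c * f j = c' * g j) ->
  forall p, relations f p -> relations g p.
Proof.
move=> d_gt0 formf reg_c' fg p relp.
rewrite /relations (pihomog_partitionE (leqnn (msize p))) eval_at_sum.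
rewrite big1 // => e _.
apply: (@lregX _ _ e reg_c'); rewrite mulr0.
have hom_e := pihomogP mdeg e p.
rewrite -(mmap_homog_scale (in_alg R) g c' hom_e).
rewrite (_ : (fun j => _) = fun j => c * f j); last first.
  by apply: funext => j; rewrite fg.
rewrite (mmap_homog_scale (in_alg R) f c hom_e).
rewrite -/(eval_at f _).
by have -> := relations_homog e d_gt0 formf relp; rewrite mulr0.
Qed.

End Relations.

(** * Rees equations and their derivatives *)

Section Jacobian.

Variables (k : fieldType) (n m : nat).
Variables (R : comAlgType k) (pi : {lrmorphism {mpoly k[n]} -> R}).
Variables (g : 'I_m -> R).

(** Setting t = 1 turns Rees equations into relations in [R]. *)
Lemma rees_map_at1 (Q : {mpoly {mpoly k[n]}[m]}) :
  (rees_map g (map_mpoly pi Q)).[1] = mmap pi g Q.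
Proof.
have -> : map_mpoly pi Q = \sum_(mu <- msupp Q) (pi Q@_mu)%:MP * 'X_[mu].
  by apply: eq_bigr => mu _; rewrite mmap1_id.
rewrite /rees_map raddf_sum horner_sum; apply: eq_bigr => mu _.
rewrite /= rmorphM /= mmapC mmapX hornerM hornerC; congr (_ * _).
rewrite /mmap1 horner_prod; apply: eq_bigr => j _.
by rewrite horner_exp hornerZ hornerX mulr1.
Qed.

(** Euler's formula in X-degree 1, with the Y_j replaced by the g_j. *)
Lemma dX_sum (Q : {mpoly {mpoly k[n]}[m]}) :
    (forall mu, Q@_mu \is 1.-homog) ->
  \sum_j eval_at g (dX j Q) * pi 'X_j = mmap pi g Q.
Proof.
move=> homQ.
have evalE j : eval_at g (dX j Q) =
    \sum_(mu <- msupp Q) (Q@_mu)@_U_(j) *: mmap1 g mu.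
  rewrite /dX /map_mpoly /mmap eval_at_sum; apply: eq_bigr => mu _.
  rewrite /= mmap1_id mcoeff_deriv add0m mnm0E mulr1n eval_atM /eval_at.
  by rewrite mmapC mmapX /= mulr_algl.
under eq_bigr do rewrite evalE mulr_suml.
rewrite exchange_big /=; apply: eq_bigr => mu _.
rewrite {2}(linear_form_sum (homQ mu)) linear_sum mulr_suml.
by apply: eq_bigr => j _; rewrite linearZ -!scalerAl mulrC.
Qed.

End Jacobian.

(** * Transfer along ring morphisms *)

Lemma rmorph_mmap n (K A B : comNzRingType) (h : {rmorphism K -> A})
    (phi : {rmorphism A -> B}) (x : 'I_n -> A) p :
  phi (mmap h x p) = mmap (phi \o h) (phi \o x) p.
Proof.
rewrite /mmap rmorph_sum; apply: eq_bigr => mu _; rewrite rmorphM.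
congr (_ * _); rewrite /mmap1 rmorph_prod.
by apply: eq_bigr => i _; rewrite rmorphXn.
Qed.

Section EqBase.

Variables (k : fieldType) (A : comNzRingType) (i1 i2 : {rmorphism k -> A}).
Hypothesis i12 : i1 =1 i2.

Lemma eq_adjoin s : adjoin i1 s = adjoin i2 s.
Proof.
elim: s => [|y s IHs] /=; last by rewrite IHs.
by apply: funext => x; apply: propext; split=> -[c ->]; exists c; rewrite i12.
Qed.

End EqBase.

(** Serves to compare the maps from k to the residue field through [R] and through [S], known to
    agree pointwise. *)
Lemma eq_indep (k L : fieldType) (i1 i2 : {rmorphism k -> L}) s :
  i1 =1 i2 -> indep i1 s -> indep i2 s.
Proof.
move=> i12; elim: s => //= x s IHs [nsx inds]; split; last exact: IHs.
by rewrite /acl -(eq_adjoin i12).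
Qed.

Lemma kernel_prime (A : comNzRingType) (L : fieldType)
    (phi : {rmorphism A -> L}) : prime_ideal (fun x => phi x = 0).
Proof.
split.
- split; first exact: rmorph0.
  + by move=> x y x0 y0; rewrite rmorphD x0 y0 addr0.
  + by move=> c x x0; rewrite rmorphM x0 mulr0.
- by apply/eqP; rewrite rmorph1 oner_neq0.
- move=> x y /eqP; rewrite rmorphM mulf_eq0.
  by case/orP=> /eqP; [left | right].
Qed.

(** Preimages under [sigma] are chosen arbitrarily; evaluation at [g] does not depend on the choice,
    as it vanishes on the kernel of [sigma]. *)
Lemma quotient_relations_embedding (k : fieldType) (m : nat)
    (R S : comAlgType k) (g : 'I_m -> R)
    (sigma : {lrmorphism {mpoly k[m]} -> S}) :
    is_quotient (relations g) sigma ->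
  exists theta : {rmorphism S -> R}, forall p, theta (sigma p) = eval_at g p.
Proof.
move=> [surj ker]; have /choice[tau tauK] := surj.
pose theta s := eval_at g (tau s).
have thetaE p : theta (sigma p) = eval_at g p.
  apply/eqP; rewrite -subr_eq0 -eval_atB; apply/eqP/ker.
  by rewrite rmorphB /= tauK subrr.
have thetaB : zmod_morphism theta.
  by move=> x y; rewrite -{1}(tauK x) -{1}(tauK y) -rmorphB thetaE eval_atB.
have thetaM : monoid_morphism theta.
  split; first by rewrite -(rmorph1 sigma) thetaE eval_at1.
  by move=> x y; rewrite -{1}(tauK x) -{1}(tauK y) -rmorphM thetaE eval_atM.
pose thB := GRing.isZmodMorphism.Build S R theta thetaB.
pose thM := GRing.isMonoidMorphism.Build S R theta thetaM.
pose th : {rmorphism S -> R} := HB.pack theta thB thM.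
by exists th.
Qed.

(** * The dimension bound for a fixed representative *)

Section Bound.

Variables (k : fieldType) (n m : nat) (a : {mpoly k[n.+1]} -> Prop).
Variables (R : comAlgType k) (pi : {lrmorphism {mpoly k[n.+1]} -> R}).
Hypotheses (hR : is_quotient a pi).
Variables (g : 'I_m.+1 -> R).
Variables (S : comAlgType k) (sigma : {lrmorphism {mpoly k[m.+1]} -> S}).
Hypotheses (hS : is_quotient (relations g) sigma).

Lemma rees_1_ideal_kernel Q : rees_1_ideal pi g Q -> rees_map g Q = 0.
Proof.
move=> /(_ (fun Q' => rees_map g Q' = 0)); apply; last by move=> P [q []].
split; first exact: raddf0.
- move=> P P' P0 P'0; rewrite /rees_map raddfD /= -!/(rees_map g _).
  by rewrite P0 P'0 addr0.
- by move=> P P' P0; rewrite /rees_map rmorphM /= -!/(rees_map g _) P0 mulr0.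
Qed.

(** Treats both blocks alike, a linear form of [a] being constant in Y. Combined with [dX_sum], it
    shows that [psi] kills the column of the x_i. *)
Lemma jacobian_dual_row r s (psi : 'M[S]_(r + s, n.+1)) i :
    jacobian_dual_matrix a pi sigma g psi ->
  exists Q : {mpoly {mpoly k[n.+1]}[m.+1]},
    [/\ forall j, psi i j = sigma (dX j Q), forall mu, Q@_mu \is 1.-homog
      & mmap pi g Q = 0].
Proof.
have [_ pi0] := hR; move=> [l [P [q [[la _ _] bihom [gensP _] ->]]]].
case: (split_ordP i) => j ->.
  exists (l j)%:MP; have [/pi0 lj0 homl] := la j; split.
  - by move=> c; rewrite col_mxEu mxE.
  - by move=> mu; rewrite mcoeffC mulr_natr; apply: rpredMn.
  - by rewrite mmapC.
exists (P j); split.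
- by move=> c; rewrite col_mxEd mxE.
- by case: (bihom j).
rewrite -rees_map_at1 rees_1_ideal_kernel ?horner0 //.
by apply/gensP => I idI; apply; exists j.
Qed.

Variables (theta : {rmorphism S -> R}).
Hypothesis thetaE : forall p, theta (sigma p) = eval_at g p.

Lemma theta_inj s : theta s = 0 -> s = 0.
Proof.
by have [surj ker] := hS; have [p <-] := surj s; rewrite thetaE => /ker.
Qed.

(** [theta] identifies [S] with k[g], over which [R] is torsionfree. *)
Lemma theta_regular s :
  torsionfree_over (in_subalg g) -> GRing.lreg s -> GRing.lreg (theta s).
Proof.
have [surj _] := hS; move=> tf regs x y /eqP.
rewrite -subr_eq0 -mulrBr => /eqP xy; apply/eqP; rewrite -subr_eq0; apply/eqP.
apply: tf xy; first by have [p <-] := surj s; exists p.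
move=> _ [q ->]; rewrite -thetaE -rmorphM => /theta_inj.
by rewrite -[0](mulr0 s) => /regs ->; rewrite rmorph0.
Qed.

Lemma krull_dim_bound d r s (psi : 'M[S]_(r + s, n.+1)) rho :
    rational_datum pi d g -> jacobian_dual_matrix a pi sigma g psi ->
    has_rank psi rho ->
  (krull_dim R + rho <= krull_dim S + n)%N.
Proof.
move=> [d_gt0 formg tf gP] jac [_ [x minx regx]].
have gensR := quotient_adjoin hR; have gensS := quotient_adjoin hS.
have [surj _] := hS.
have [P [z [minP indz sizez]]] := krull_dim_minimal_prime gensR.
have [prP _] := minP; have [idP _ _] := prP.
have [L [phi kerP]] := residue_field prP.
pose iota : {rmorphism k -> L} := phi \o in_alg R.
pose M := map_mx (phi \o theta) psi.
(* If all the [rho]-minors mapped to 0, so would the regular element [x] of the ideal they generate;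
   but its image in [R] is regular, hence outside the minimal prime [P]. *)
have [u [v minor0]] : exists u v, \det (@mxsub _ _ _ rho rho u v M) != 0.
  apply: contrapT => nominor.
  have nPx := minimal_prime_regular minP (theta_regular tf regx).
  apply: nPx; apply/kerP.
  apply: (minx (fun y => phi (theta y) = 0)).
    by case: (kernel_prime (phi \o theta)).
  move=> y [u [v ->]]; apply: contrapT => /eqP yn0; apply: nominor.
  by exists u, v; rewrite -map_mxsub det_map_mx.
have /choice[F FE] j : exists q, q \is d.-homog /\ pi q = g j.
  by have [q] := formg j; exists q.
have codomE : codom (phi \o g) = map phi (codom g).
  by rewrite /codom /image_mem map_comp.
have [w sizew xw] : exists2 w, (size w + rho)%N = n &
    forall i, acl iota (codom (phi \o g) ++ w) (phi (pi 'X_i)).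
  apply: (@projective_generators k L iota n m.+1 (r + s) rho d
    (fun i => phi (pi 'X_i)) (phi \o g) F M u v) => //.
  - by move=> j; case: (FE j).
  - move=> j; case: (FE j) => _ /= <-.
    by rewrite eval_at_X /eval_at rmorph_mmap.
  (* By the definition of a rational datum, the g_j do not all lie in the minimal prime [P]. *)
  - apply: contrapT => g0; apply: (gP P minP) => y; apply=> // _ [j ->].
    by apply/kerP; apply: contrapT => /eqP gj0; apply: g0; exists j.
  - move=> i j; rewrite codomE mxE /=; have [p <-] := surj (psi i j).
    by rewrite thetaE; apply/adjoin_map/eval_at_adjoin.
  - move=> i; have [Q [psiE homQ Q0]] := jacobian_dual_row i jac.
    rewrite -[RHS](rmorph0 phi) -Q0 -(dX_sum pi g homQ) rmorph_sum.
    by apply: eq_bigr => j _; rewrite mxE /= psiE thetaE rmorphM.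
(* A transcendence basis of the field generated by the g_j, chosen among them. It lifts to [S],
   where it is independent modulo the kernel of [phi \o theta], so its size is at most dim S. *)
have [b indb [bg gb]] := indep_basis iota (codom (phi \o g)).
have [|bS bE] :=
  @map_sub_lift S L (phi \o theta) [seq sigma 'X_j | j : 'I_m.+1] b.
  move=> y /bg/codomP[j ->]; apply/mapP.
  exists (sigma 'X_j); first exact: codom_f.
  by rewrite /= thetaE /eval_at mmapX mmap1U.
have le_b : (size b <= krull_dim S)%N.
  rewrite bE size_map.
  apply: (krull_dim_indep gensS (kernel_prime (phi \o theta))).
  apply/(@indep_modP _ _ _ L (phi \o theta)) => //; rewrite -bE.
  apply: eq_indep indb => c /=; rewrite -(rmorph1 sigma) -linearZ thetaE.
  by rewrite -mul_mpolyC mulr1 /eval_at mmapC.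
have le_z : (size z <= size b + size w)%N.
  rewrite -(size_map phi z) -size_cat.
  apply: (@indep_size _ _ iota); first exact/indep_modP.
  move=> _ /mapP[y _ ->].
  have := adjoin_map phi (gensR y); apply: acl_adjoin_trans.
  move=> _ /mapP[_ /codomP[i ->] ->].
  apply: acl_trans (xw i) => y'; rewrite mem_cat => /orP[/gb|wy].
    by apply: acl_sub => t tb; rewrite mem_cat tb.
  by apply: acl_mem; rewrite mem_cat wy orbT.
rewrite -sizez -sizew addnA leq_add2r; apply: leq_trans le_z _.
by rewrite leq_add2r.
Qed.

End Bound.

Theorem proposition1p15 (k : fieldType) (n m : nat)
    (a : {mpoly k[n.+1]} -> Prop)
    (R : comAlgType k) (pi : {lrmorphism {mpoly k[n.+1]} -> R})
    (ha : homogeneous_ideal a) (hR : is_quotient a pi)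
    (hred : reduced R) (hdim : (1 <= krull_dim R)%N)
    (FF : ('I_m.+1 -> R) -> Prop) (hFF : rational_map pi FF)
    (f : 'I_m.+1 -> R) (hf : FF f)
    (S : comAlgType k) (sigma : {lrmorphism {mpoly k[m.+1]} -> S})
    (hS : is_quotient (relations f) sigma)
    (hjd : has_jdrank a pi sigma FF) :
  ((krull_dim R)%:Z - (krull_dim S)%:Z <= n%:Z - (jdrank a pi sigma FF)%:Z) /\
  (n%:Z - (jdrank a pi sigma FF)%:Z
     = (edim pi)%:Z - 1 - jdrank_plus a pi sigma FF).
Proof.
(* The epsilon choice yields a representative [g], possibly other than [f], with a matrix whose rank
   is [jdrank]. *)
have [g [r [s [psi [FFg jac rank]]]]] := the_natP hjd.
rewrite -/(jdrank a pi sigma FF) in rank.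
have [f0 _ FFE] := hFF.
have [[df datumf] [F1 [G1 [_ _ regF1 regG1 fE]]]] := (FFE f).1 hf.
have [[dg datumg] [F2 [G2 [_ _ regF2 regG2 gE]]]] := (FFE g).1 FFg.
have [df_gt0 formf _ _] := datumf; have [dg_gt0 formg _ _] := datumg.
(* Both [f] and [g] are proportional to [f0], which is eliminated. *)
have fgE j : G2 * F1 * f j = G1 * F2 * g j by rewrite -!mulrA fE gE mulrCA.
(* [psi] is attached to [g] while [S] is presented through [f]; the proportionality factors are
   regular, so the relations coincide. *)
have hSg : is_quotient (relations g) sigma.
  have [surj ker] := hS; split=> // p; split=> [/ker|relp].
    by apply: (relations_proportional ha hR df_gt0 formf _ fgE); apply: lregM.
  apply/ker; apply: (relations_proportional ha hR dg_gt0 formg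
    (c := G1 * F2) (c' := G2 * F1)) relp => //.
  exact: lregM.
have [theta thetaE] := quotient_relations_embedding hSg.
have bound := krull_dim_bound hR hSg thetaE datumg jac rank.
(* The data of [psi] include a basis of the linear part of [a], from which dgi + edim = n + 1 and
   hence the equality. *)
have [l [_ [_ [lbasis _ _ _]]]] := jac.
have dimE := edim_dgi hR lbasis.
by rewrite /jdrank_plus; split; lia.
Qed.
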